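(* Fix $d\in\mathbb N$. For each $n\ge1$, let $G_n$ be a graph on $n+1$ vertices with one vertex of degree $n$ (the ''sink'') and all others of degree at most $d$. Let $V_n$ be the set of vertices obtained by removing the sink, let $K_n=P_{G_n}[V_n]$ be the restriction to $V_n^2$ of the random-walk transition matrix $P_{G_n}$ of $G_n$, let $\nu_n$ be the uniform law on $V_n$, and let $\lambda_n\in(0,\infty)$. Then, as $n\to\infty$, the $\mathrm{ARW}(K_n,\lambda_n,\nu_n)$ chain satisfies $$t_{\mathrm{rel}}^{(n)}=\Theta(n),\qquad t_{\mathrm{sep}}^{(n)}=\Theta(n\log n),$$ and there is a separation cutoff with window $O(n\sqrt{\log n})$.
   Context: Graph notions: $P_{G}(x,y)=1/\deg(x)$ if $\{x,y\}$ is an edge of $G$ and $0$ otherwise. Given a finite set $V$ and a sub-stochastic matrix $K\colon V^2\to[0,1]$ (i.e. $\sum_{y}K(x,y)\le1$) having no stochastic principal sub-matrix, a $K$-walk is the killed random walk which, when alive at $x$, jumps to $y\in V$ at rate $K(x,y)$ and is killed at rate $1-\sum_yK(x,y)$. ARW dynamics with sleeping rate $\lambda\in(0,\infty)$: a configuration is $\eta\in\{0,\mathrm s,1,2,\ldots\}^V$; the site $x$ is empty if $\eta(x)=0$, holds one sleeping particle if $\eta(x)=\mathrm s$, and holds $k\ge1$ active particles if $\eta(x)=k$. In continuous time, active particles perform independent $K$-walks (a killed particle is removed), but fall asleep at rate $\lambda$ when alone on a site; sleeping particles do not move, but become active upon contact with another particle. Configurations in $\{0,\mathrm s\}^V$ are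 stable, and from any configuration with finitely many particles the process is almost surely absorbed in a stable configuration. The $\mathrm{ARW}(K,\lambda,\nu)$ chain is the discrete-time Markov chain on $\mathcal X=\{0,\mathrm s\}^V$ which at each step adds one active particle to the current state at an independent $\nu$-distributed random site and then runs the ARW dynamics until a stable configuration is obtained; the latter is the new state. Its transition matrix $P$ is irreducible and aperiodic, with unique invariant distribution $\pi$. $t_{\mathrm{rel}}:=\frac1{1-\rho}$ with $\rho:=\max\{|z|\colon z\in\mathbb C\setminus\{1\}\text{ is an eigenvalue of }P\}$; $d_{\mathrm{sep}}(t):=\max_{\eta,\eta'\in\mathcal X}\big(1-\frac{P^t(\eta,\eta')}{\pi(\eta')}\big)$; $t_{\mathrm{sep}}(\varepsilon):=\inf\{t\in\mathbb N\colon d_{\mathrm{sep}}(t)\le\varepsilon\}$, $t_{\mathrm{sep}}:=t_{\mathrm{sep}}(1/2)$, with $\mathbb N=\{0,1,2,\dots\}$. Quantities of the $n$-th chain carry the superscript $(n)$. A sequence of chains exhibits separation cutoff if for any fixed $\alpha\ge0$, $d_{\mathrm{sep}}^{(n)}(\lfloor\alpha t_{\mathrm{sep}}^{(n)}\rfloor)$ tends to $1$ if $\alpha<1$ and to $0$ if $\alpha>1$. The cutoff has window $O(w_n)$ if moreover, for every fixed $\varepsilon\in(0,1/2)$, $t_{\mathrm{sep}}^{(n)}(\varepsilon)-t_{\mathrm{sep}}^{(n)}(1-\varepsilon)=O(w_n)$. *)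

(* Defs.v *)
From HB Require Import structures.
From mathcomp Require Import all_boot all_order all_algebra.
From mathcomp Require Import complex.
From mathcomp Require Import all_classical all_reals all_analysis.

Set Implicit Arguments.
Unset Strict Implicit.
Unset Printing Implicit Defensive.

Import Order.TTheory GRing.Theory Num.Theory.
Import numFieldNormedType.Exports.

Local Open Scope classical_set_scope.
Local Open Scope ring_scope.

Section Graph.
Variables (R : realType) (T : finType) (e : rel T).

Definition deg (x : T) : nat := #|[set y | e x y]%SET|.

Definition rw_kernel (x y : T) : R := if e x y then (deg x)%:R^-1 else 0.

Definition restrict_kernel (s : T) (K : T -> T -> R)
  (x y : {x : T | x != s}) : R := K (val x) (val y).

(* Simple graph on [n + 1] vertices in which [s] (the sink) has degree [n] and
   every other vertex has degree at most [d]. *)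
Definition sink_graph (d n : nat) (s : T) : Prop :=
  [/\ #|T| = n.+1, symmetric e, irreflexive e, deg s = n
    & forall x, x != s -> (deg x <= d)%N].

End Graph.

Section ARW.
Variables (R : realType) (V : finType).

(* [eta x = None] : one sleeping particle at [x];
   [eta x = Some k] : [k] active particles at [x] ([Some 0] : empty site). *)
Definition config := {ffun V -> option nat}.

Definition nactive (eta : config) (x : V) : nat := odflt 0%N (eta x).

(* A particle arriving at a sleeping one wakes it up: two active particles. *)
Definition add_active (x : V) (eta : config) : config :=
  [ffun z => if z == x then
     if eta z is Some k then Some k.+1 else Some 2%N
   else eta z].

(* Only used at sites where [nactive eta x > 0]. *)
Definition remove_active (x : V) (eta : config) : config :=
  [ffun z => if z == x then
     if eta z is Some k then Some k.-1 else None
   else eta z].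

Definition fall_asleep (x : V) (eta : config) : config :=
  [ffun z => if z == x then None else eta z].

Variables (K : V -> V -> R) (lambda : R).

(* Generator of the continuous-time dynamics: each active particle at [x] jumps
   to [y] at rate [K x y] and is killed at rate [1 - \sum_y K x y]; a particle
   alone at [x] and active falls asleep at rate [lambda]. *)
Definition arw_gen (f : config -> R) (eta : config) : R :=
  \sum_(x : V)
    (\sum_(y : V) (nactive eta x)%:R * K x y
         * (f (add_active y (remove_active x eta)) - f eta)
     + (nactive eta x)%:R * (1 - \sum_(y : V) K x y)
         * (f (remove_active x eta) - f eta)
     + (if eta x == Some 1%N then lambda else 0)
         * (f (fall_asleep x eta) - f eta)).

(* Semigroup [exp (t L)] of the generator [L]. The number of particles never
   increases, so finitely many configurations are reachable from [eta] and the
   exponential series converges absolutely. *)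
Definition arw_semigroup (t : R) (f : config -> R) (eta : config) : R :=
  limn (series (fun k => t ^+ k / k`!%:R * iter k arw_gen f eta)).

(* Probability that the dynamics started from [eta] is absorbed in [zeta], for
   [zeta] stable: limit of the probability to be in [zeta] at time [t]. *)
Definition absorption_prob (eta zeta : config) : R :=
  lim (arw_semigroup t (fun xi => (xi == zeta)%:R) eta @[t --> +oo%R]).

(* Elements of {0, s}^V, [true] standing for [s]. *)
Definition stable_config := {ffun V -> bool}.

Definition config_of_stable (eta : stable_config) : config :=
  [ffun x => if eta x then None else Some 0%N].

Variable nu : V -> R.

Definition arw_prob (eta eta' : stable_config) : R :=
  \sum_(x : V) nu x * absorption_prob (add_active x (config_of_stable eta))
                                      (config_of_stable eta').

Definition arw_mx : 'M[R]_#|stable_config| :=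
  \matrix_(i, j) arw_prob (enum_val i) (enum_val j).

End ARW.

Definition uniform_law (R : realType) (V : finType) (x : V) : R := #|V|%:R^-1.

Section Mixing.
Variables (R : realType) (m : nat) (P : 'M[R]_m).

Definition is_invariant_law (p : 'rV[R]_m) : Prop :=
  [/\ forall i, 0 <= p 0 i, \sum_i p 0 i = 1 & p *m P = p].

Definition invariant_law : 'rV[R]_m := xget 0 [set p | is_invariant_law p].

(* The suprema in [spectral_rho] and [dsep] are over finite sets, hence maxima
   as soon as these sets are nonempty. *)
Definition spectral_rho : R :=
  sup [set Normc.normc z | z in
    [set z : R[i] | z != 1 /\ eigenvalue (map_mx (real_complex R) P) z]].

Definition trel : R := (1 - spectral_rho)^-1.

Definition dsep (t : nat) : R :=
  sup [set 1 - (P ^+ t) ij.1 ij.2 / invariant_law 0 ij.2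
      | ij in [set: 'I_m * 'I_m]].

(* A natural number, viewed as a real. *)
Definition tsep_eps (eps : R) : R :=
  inf [set t%:R | t in [set t : nat | dsep t <= eps]].

Definition tsep : R := tsep_eps (2^-1).

End Mixing.

Section Cutoff.
Variables (R : realType) (m : nat -> nat) (P : forall n, 'M[R]_(m n)).

Definition separation_cutoff : Prop :=
  forall alpha : R, 0 <= alpha ->
    (alpha < 1 ->
       dsep (P n) (Num.truncn (alpha * tsep (P n))) @[n --> \oo] --> (1 : R)) /\
    (1 < alpha ->
       dsep (P n) (Num.truncn (alpha * tsep (P n))) @[n --> \oo] --> (0 : R)).

Definition separation_cutoff_window (w : nat -> R^o) : Prop :=
  separation_cutoff /\
  forall eps : R, 0 < eps -> eps < 2^-1 ->
    ((fun n => tsep_eps (P n) eps - tsep_eps (P n) (1 - eps)) : nat -> R^o)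
      =O_\oo w.

End Cutoff.

Definition sink_arw_mx (R : realType) (T : finType) (e : rel T) (s : T)
    (lambda : R) :=
  arw_mx (restrict_kernel (s := s) (rw_kernel R e)) lambda (@uniform_law R _).

(* Main.v *)
(* The abelian property reduces the chain to a random growing set. A new
   particle may first walk until it finds an empty site (or is killed), the
   particles met on the way being kept from falling asleep; this internal DLA,
   started from the empty set, fills [V] at a random time [tau], after which the
   configuration can be stabilized from one active particle per site, which has
   the invariant law. Since the state with all sites asleep cannot be reached before [tau], the
   separation distance is exactly [P(tau > t)].

   The set [B] of filled sites gains a given [z] with probability [a_B(z)] between
   [1/n] (start at [z]) and [d/n] (reversibility of the walk, killed at rate at
   least [1/d]). Hence [P(tau > t) <= n (1 - 1/n)^t], so all the eigenvalues other
   than [1] have modulus at most [1 - 1/n], while stabilizing from [V] minus one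
   site [x] produces an eigenvalue [1 - a_(V - x)(x) >= 1 - d/n]. The same bounds
   place [m = E(tau)] between [n H_n / d] and [n H_n]. Adding one site to the set
   lowers the expected remaining time by at most [n], which makes
   [(t + h(B_t) - m)^2 + n h(B_t)] a supermartingale, where [h(B)] is the expected
   time to fill [V] from [B]: the variance of [tau] is at most [n m], whence the
   cutoff at [m] with window [sqrt (n m)]. *)
Require Import Defs.
From HB Require Import structures.
From mathcomp Require Import all_boot all_order all_algebra.
From mathcomp Require Import complex ring lra.
From mathcomp Require Import all_classical all_reals all_analysis.

Set Implicit Arguments.
Unset Strict Implicit.
Unset Printing Implicit Defensive.

Import Order.TTheory GRing.Theory Num.Theory.
Import numFieldNormedType.Exports.

Local Open Scope classical_set_scope.
Local Open Scope ring_scope.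

(** No trajectory is constructed: the chain is given by limits of exponential series, so every
    probabilistic statement becomes one about functions of the configuration. The central notion is
    [topple_fixed], a function preserved in expectation by the toppling of any site. A bounded such
    function is determined by its values on stable configurations, because particles are killed at a
    rate bounded below. Hence the law of the final state does not depend on the order of the
    topplings, and moving one particle while the others wait amounts to an algebraic identity. A
    particle sharing its site cannot fall asleep, so its walk follows [K] exactly.

    The growing set starts empty whatever the initial state: a newcomer may be left on top of a
    sleeping particle, which it merely wakes. The filling time thus has the same law from every
    state, which gives a lower bound on all the entries of [P ^ t] at once. *)

Lemma big_option (R : nmodType) (T : finType) (F : option T -> R) :
  \sum_i F i = F None + \sum_x F (Some x).
Proof.
rewrite (bigD1 None) //=; congr (_ + _).
rewrite (reindex_omap Some id) /=; last by case.
by apply: eq_bigl => x; rewrite eqxx.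
Qed.

(** * Fixed points as limits of increasing iterations *)

Section IncreasingIteration.
Variables (R : realType) (X : Type) (Phi : (X -> R) -> X -> R) (u0 : X -> R).
Hypothesis Phi_mono :
  forall u v, (forall x, u x <= v x) -> forall x, Phi u x <= Phi v x.
Hypothesis Phi_cont : forall (u : nat -> X -> R) (v : X -> R),
  (forall x, u n x @[n --> \oo] --> v x) ->
  forall x, Phi (u n) x @[n --> \oo] --> Phi v x.
Hypothesis u0_le : forall x, u0 x <= Phi u0 x.
Hypothesis u0_le1 : forall x, u0 x <= 1.
Hypothesis Phi_le1 :
  forall u, (forall x, u x <= 1) -> forall x, Phi u x <= 1.

Definition iter_limit x : R := limn (fun n => iter n Phi u0 x).

Lemma iter_le1 n x : iter n Phi u0 x <= 1.
Proof. by elim: n x => [|n IHn] x /=; [exact: u0_le1|apply: Phi_le1]. Qed.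

Lemma iter_nondecreasing x : nondecreasing_seq (fun n => iter n Phi u0 x).
Proof.
apply/nondecreasing_seqP => n.
by elim: n x => [|n IHn] x /=; [exact: u0_le|apply: Phi_mono].
Qed.

Lemma cvg_iter_limit x : iter n Phi u0 x @[n --> \oo] --> iter_limit x.
Proof.
apply: nondecreasing_is_cvgn; first exact: iter_nondecreasing.
by exists 1 => _ [n _ <-]; exact: iter_le1.
Qed.

Lemma iter_limit_fixed x : Phi iter_limit x = iter_limit x.
Proof.
have h1 := @Phi_cont _ _ cvg_iter_limit x.
have h2 := @cvg_iter_limit x; rewrite -cvg_shiftS in h2.
exact: (cvg_unique _ h1 h2).
Qed.

Lemma iter_le_limit n x : iter n Phi u0 x <= iter_limit x.
Proof.
apply: nondecreasing_cvgn_le; first exact: iter_nondecreasing.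
by apply/cvg_ex; exists (iter_limit x); exact: cvg_iter_limit.
Qed.

Lemma iter_limit_le v : (forall n x, iter n Phi u0 x <= v x) ->
  forall x, iter_limit x <= v x.
Proof.
move=> uv x; apply: limr_le; last by near=> n; exact: uv.
by apply/cvg_ex; exists (iter_limit x); exact: cvg_iter_limit.
Unshelve. all: by end_near. Qed.

End IncreasingIteration.

(** * Toppling instructions and their commutation *)

Section Toppling.
Variables (R : realType) (V : finType) (K : V -> V -> R) (lambda : R).
Implicit Types (x y z : V) (eta xi : config V) (f g : config V -> R).

Definition kill_rate x : R := 1 - \sum_y K x y.

(* [None] : fall asleep; [Some None] : be killed; [Some (Some y)] : jump to
   [y]. *)
Definition instr_law x (i : option (option V)) : R :=
  match i with
  | None => lambda
  | Some None => kill_rate x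
  | Some (Some y) => K x y
  end / (1 + lambda).

Definition instr_act x (i : option (option V)) eta : config V :=
  if nactive eta x == 0%N then eta else
  match i with
  | None => if eta x == Some 1%N then fall_asleep x eta else eta
  | Some None => remove_active x eta
  | Some (Some y) => add_active y (remove_active x eta)
  end.

Definition topple x f eta : R := \sum_i instr_law x i * f (instr_act x i eta).

Definition topple_fixed f := forall x eta, topple x f eta = f eta.

Lemma nactive_gt0P eta x :
  reflect (exists k, eta x = Some k.+1) (nactive eta x != 0)%N.
Proof.
rewrite /nactive; case: (eta x) => [[|k]|] /=; constructor.
- by case.
- by exists k.
- by case.
Qed.

Lemma add_activeC x y eta :
  add_active x (add_active y eta) = add_active y (add_active x eta).
Proof.
apply/ffunP => z; rewrite !ffunE.
by case: (z == x); case: (z == y); case: (eta z).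
Qed.

Lemma remove_add_active x k eta :
  eta x = Some k -> remove_active x (add_active x eta) = eta.
Proof.
move=> ex; apply/ffunP => z; rewrite !ffunE.
by case: (z =P x) => // ->; rewrite ex.
Qed.

Lemma nactive_add_active x y eta :
  nactive eta x != 0%N -> nactive (add_active y eta) x != 0%N.
Proof.
case/nactive_gt0P => k ex; rewrite /nactive ffunE ex.
by case: (x == y).
Qed.

Lemma nactive_instr_act x y i eta : x != y ->
  nactive eta x != 0%N -> nactive (instr_act y i eta) x != 0%N.
Proof.
move=> xy ax; rewrite /instr_act; case: ifP => // _.
have h : nactive (remove_active y eta) x != 0%N.
  by rewrite /nactive ffunE (negbTE xy).
case: i => [[z|]|] //; first exact: nactive_add_active.
by case: ifP => // _; rewrite /nactive ffunE (negbTE xy).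
Qed.

(** The delicate case is a sleep instruction with [x = y]: a lone particle falls asleep and is woken
    by the newcomer, or the newcomer is already there and the instruction has no effect. Both orders
    leave two active particles. *)
Lemma instr_act_add x y i eta : nactive eta x != 0%N ->
  instr_act x i (add_active y eta) = add_active y (instr_act x i eta).
Proof.
move=> ax; have ay := nactive_add_active y ax.
rewrite /instr_act (negbTE ax) (negbTE ay).
case/nactive_gt0P: ax => k ex.
have h : remove_active x (add_active y eta) = add_active y (remove_active x eta).
  apply/ffunP => z; rewrite !ffunE.
  case: (z =P x) => [->|] //; case: (x =P y) => // _; rewrite ex //.
case: i => [[z|]|] //; first by rewrite h add_activeC.
rewrite ffunE; case: (x =P y) => [<-|xy]; rewrite ex.
  case: k ex => [|k] ex //=; last first.
  apply/ffunP => z; rewrite !ffunE.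
  by case: (z =P x) => // ->; rewrite ex.
case: ifP => // _; apply/ffunP => z; rewrite !ffunE.
by case: (z =P x) => // ->; case: (x =P y).
Qed.

(** Neither instruction can deactivate the other site; the only interaction is a particle jumping
    onto it, which is the case of [instr_act_add]. *)
Lemma instr_actC x y i j eta : x != y ->
  nactive eta x != 0%N -> nactive eta y != 0%N ->
  instr_act y j (instr_act x i eta) = instr_act x i (instr_act y j eta).
Proof.
move=> xy ax ay; have yx : y != x by rewrite eq_sym.
have ax' := nactive_instr_act j xy ax; have ay' := nactive_instr_act i yx ay.
move: (ax) (ay) => /negbTE ax0 /negbTE ay0.
have H u v : u != v -> nactive eta u != 0%N -> nactive eta v != 0%N ->
   instr_act v j (remove_active u eta) = remove_active u (instr_act v j eta).
  move=> uv /nactive_gt0P[k ek] av; have vu : v != u by rewrite eq_sym.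
  have h : nactive (remove_active u eta) v != 0%N.
    by rewrite /nactive ffunE (negbTE vu).
  rewrite /instr_act (negbTE h) (negbTE av) ffunE (negbTE vu).
  have hr : remove_active v (remove_active u eta)
          = remove_active u (remove_active v eta).
    apply/ffunP => z; rewrite !ffunE.
    by case: (z =P v) => // ->; rewrite (negbTE vu).
  case: j {ax' } => [[w|]|] //.
    rewrite hr; apply/ffunP => z; rewrite !ffunE.
    case: (z =P u) => // ->; rewrite (negbTE uv) ek.
    by case: (u == w).
  case: ifP => // _; apply/ffunP => z; rewrite !ffunE.
  by case: (z =P v) => // ->; rewrite (negbTE vu).
have ar : nactive (remove_active x eta) y != 0%N.
  by rewrite /nactive ffunE (negbTE yx).
rewrite {2}/instr_act ax0 [RHS]/instr_act (negbTE ax').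
case: i {ay'} => [[z|]|].
- by rewrite instr_act_add // H.
- by rewrite H.
have sleepE v xi : (if xi v == Some 1%N then fall_asleep v xi else xi) =
    [ffun z => if (z == v) && (xi z == Some 1%N) then None else xi z].
  apply/ffunP => z; rewrite [RHS]ffunE; case: (z =P v) => [->|zv] /=.
    by case: ifP => // _; rewrite ffunE eqxx.
  by case: ifP => // _; rewrite ffunE; case: (z =P v).
have -> : instr_act y j (if eta x == Some 1%N then fall_asleep x eta else eta) =
  let xi := [ffun z => if (z == x) && (eta z == Some 1%N) then None else eta z]
  in match j with
  | None => [ffun z => if (z == y) && (xi z == Some 1%N) then None else xi z]
  | Some None => remove_active y xi
  | Some (Some y') => add_active y' (remove_active y xi)
  end.
  rewrite sleepE /= /instr_act.
  have -> : nactive [ffun z => if (z == x) && (eta z == Some 1%N) then None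
                               else eta z] y == 0%N = false.
    by apply: negbTE; rewrite /nactive ffunE (negbTE yx).
  by case: j {ax' H} => [[w|]|] //; rewrite sleepE.
rewrite sleepE /= /instr_act ay0.
case/nactive_gt0P: ax {ax' H} => k ek; case/nactive_gt0P: ay => l el.
case: j => [[w|]|]; rewrite ?sleepE; apply/ffunP => z; rewrite !ffunE;
  (have [zx|_] := eqVneq z x; rewrite ?zx ?(negbTE xy) //=);
  rewrite ?andbF //.
by rewrite ek; case: (x == w) => /=; case: k {ek} => [|[|k]].
Qed.

End Toppling.

(** * Abelian property *)

Section Abelian.
Variables (R : realType) (V : finType) (K : V -> V -> R) (lambda : R).
Implicit Types (x y z : V) (eta xi : config V) (f g : config V -> R).
Implicit Types (zeta : stable_config V).
Hypothesis K_ge0 : forall x y, 0 <= K x y.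
Hypothesis kill_ge0 : forall x, 0 <= kill_rate K x.
Hypothesis lambda_gt0 : 0 < lambda.

Local Notation tpl := (topple K lambda).
Local Notation law := (instr_law K lambda).

Lemma lambda1_gt0 : 0 < 1 + lambda.
Proof. by rewrite addr_gt0. Qed.

Lemma instr_law_ge0 x i : 0 <= law x i.
Proof.
rewrite /instr_law divr_ge0 // ?(ltW lambda1_gt0) //.
by case: i => [[y|]|] //; exact: ltW.
Qed.

Lemma sum_instr_law x : \sum_i law x i = 1.
Proof.
rewrite -mulr_suml !big_option /= /kill_rate subrK addrC divff //.
by rewrite gt_eqF // lambda1_gt0.
Qed.

Lemma topple_mono x f g : (forall xi, f xi <= g xi) ->
  forall eta, tpl x f eta <= tpl x g eta.
Proof.
by move=> fg eta; apply: ler_sum => i _; rewrite ler_wpM2l ?instr_law_ge0.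
Qed.

Lemma topple_inactive x f eta : nactive eta x = 0%N -> tpl x f eta = f eta.
Proof.
move=> e0; rewrite /topple /instr_act e0 eqxx /= -mulr_suml sum_instr_law.
by rewrite mul1r.
Qed.

Lemma toppleC x y f eta : x != y ->
  nactive eta x != 0%N -> nactive eta y != 0%N ->
  tpl x (tpl y f) eta = tpl y (tpl x f) eta.
Proof.
move=> xy ax ay.
transitivity (\sum_i \sum_j law x i * law y j *
    f (instr_act y j (instr_act x i eta))).
  by apply: eq_bigr => i _; rewrite mulr_sumr; apply: eq_bigr => j _; rewrite mulrA.
rewrite exchange_big /=; apply: eq_bigr => j _; rewrite mulr_sumr.
by apply: eq_bigr => i _; rewrite instr_actC // mulrA [_ * law y j]mulrC.
Qed.

(* For [f] the indicator of a stable configuration, and after any number of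
   topplings, toppling more can only increase the probability. *)
Definition subharmonic f := forall x eta, f eta <= tpl x f eta.

(* The abelian property in law: for distinct active sites the two topplings
   commute, and in the other cases one of them is trivial. *)
Lemma subharmonic_topple y f : subharmonic f -> subharmonic (tpl y f).
Proof.
move=> sf x eta; have [->|xy] := eqVneq x y.
  exact: topple_mono (sf y) _.
have [ax|ax] := eqVneq (nactive eta x) 0%N; first by rewrite [leRHS]topple_inactive.
have [ay|ay] := eqVneq (nactive eta y) 0%N.
  rewrite topple_inactive //; apply: le_trans (sf x eta) _.
  exact: topple_mono (sf y) _.
rewrite toppleC //; exact: topple_mono (sf x) _.
Qed.

Definition sweep f := foldr tpl f (enum V).

Lemma subharmonic_foldr f (s : seq V) :
  subharmonic f -> subharmonic (foldr tpl f s).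
Proof. by move=> sf; elim: s => //= y s; exact: subharmonic_topple. Qed.

Lemma foldr_topple_ge f (s : seq V) eta : subharmonic f ->
  f eta <= foldr tpl f s eta.
Proof.
move=> sf; elim: s eta => //= y s IHs eta.
exact: le_trans (IHs eta) (subharmonic_foldr s sf y eta).
Qed.

Lemma topple_le_sweep x f eta : subharmonic f -> tpl x f eta <= sweep f eta.
Proof.
move=> sf; rewrite /sweep; have : x \in enum V by rewrite mem_enum.
elim: (enum V) eta => //= y s IHs eta; rewrite inE => /predU1P[<-|/IHs xs].
  by apply: topple_mono => xi; exact: foldr_topple_ge.
exact: le_trans (xs eta) (subharmonic_foldr s sf y eta).
Qed.

Lemma foldr_topple_mono (s : seq V) f g : (forall xi, f xi <= g xi) ->
  forall eta, foldr tpl f s eta <= foldr tpl g s eta.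
Proof. by move=> fg; elim: s => //= y s IHs eta; exact: topple_mono. Qed.

Lemma topple_cst x (c : R) eta : tpl x (fun=> c) eta = c.
Proof. by rewrite /topple -mulr_suml sum_instr_law mul1r. Qed.

Lemma foldr_topple_le1 (s : seq V) f : (forall xi, f xi <= 1) ->
  forall eta, foldr tpl f s eta <= 1.
Proof.
move=> f1; elim: s => //= y s IHs eta.
by apply: le_trans (topple_mono y IHs eta) _; rewrite topple_cst.
Qed.

Lemma foldr_topple_cvg (s : seq V) (u : nat -> config V -> R) f :
  (forall eta, u n eta @[n --> \oo] --> f eta) ->
  forall eta, foldr tpl (u n) s eta @[n --> \oo] --> foldr tpl f s eta.
Proof.
move=> uf; elim: s => //= y s IHs eta.
apply: cvg_big => [|i _]; first exact: add_continuous.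
 apply: cvgMl_tmp; exact: IHs.
Qed.

Lemma nactive_stable zeta x : nactive (config_of_stable zeta) x = 0%N.
Proof. by rewrite /nactive ffunE; case: (zeta x). Qed.

Lemma foldr_topple_stable (s : seq V) f zeta :
  foldr tpl f s (config_of_stable zeta) = f (config_of_stable zeta).
Proof.
by elim: s => //= y s IHs; rewrite topple_inactive // nactive_stable.
Qed.

Lemma config_of_stable_inj : injective (@config_of_stable V).
Proof.
move=> z1 z2 /ffunP h; apply/ffunP => x; have := h x; rewrite !ffunE.
by case: (z1 x); case: (z2 x).
Qed.

Definition stable_indic zeta : config V -> R :=
  fun xi => (xi == config_of_stable zeta)%:R.

(* The law of the stabilization of [eta], obtained by toppling all the sites
   over and over. *)
Definition stab zeta eta : R := iter_limit sweep (stable_indic zeta) eta.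

Lemma subharmonic_indic zeta : subharmonic (stable_indic zeta).
Proof.
move=> x eta; have [->|h] := eqVneq eta (config_of_stable zeta).
  by rewrite topple_inactive // nactive_stable.
rewrite /stable_indic (negbTE h); apply: sumr_ge0 => i _.
by rewrite mulr_ge0 ?instr_law_ge0.
Qed.

Lemma subharmonic_iter_sweep n f : subharmonic f -> subharmonic (iter n sweep f).
Proof. by move=> sf; elim: n => //= n; exact: subharmonic_foldr. Qed.

Lemma stable_indic_le1 zeta eta : stable_indic zeta eta <= 1.
Proof. by rewrite /stable_indic; case: eqP. Qed.

Let sweep_mono := foldr_topple_mono (enum V).
Let sweep_le1 := foldr_topple_le1 (enum V).
Let indic_le zeta eta : stable_indic zeta eta <= sweep (stable_indic zeta) eta.
Proof. exact/foldr_topple_ge/subharmonic_indic. Qed.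

Lemma stab_cvg zeta eta :
  iter n sweep (stable_indic zeta) eta @[n --> \oo] --> stab zeta eta.
Proof.
apply: cvg_iter_limit => //; exact: stable_indic_le1.
Qed.

(** A squeeze: the limit inherits subharmonicity from the iterates, while one toppling of a
    subharmonic function is dominated by a whole sweep, which fixes the limit. *)
Lemma stab_fixed zeta : topple_fixed K lambda (stab zeta).
Proof.
have sub : subharmonic (stab zeta).
  move=> x; apply: iter_limit_le => //; first exact: stable_indic_le1.
  move=> n xi.
  have h := subharmonic_iter_sweep n (subharmonic_indic zeta) x xi.
  apply: le_trans h _; apply: topple_mono => xi'.
  apply: iter_le_limit => //; exact: stable_indic_le1.
move=> x eta; apply/eqP; rewrite eq_le sub andbT.
apply: le_trans (topple_le_sweep x _ sub) _.
rewrite (@iter_limit_fixed _ _ sweep (stable_indic zeta)) //.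
  exact: foldr_topple_cvg.
exact: stable_indic_le1.
Qed.

Lemma stab_ge0 zeta eta : 0 <= stab zeta eta.
Proof.
have h : stable_indic zeta eta <= stab zeta eta.
  apply: (@iter_le_limit _ _ sweep (stable_indic zeta) _ _ _ _ 0%N) => //.
  exact: stable_indic_le1.
by apply: le_trans h; rewrite /stable_indic; case: eqP.
Qed.

Lemma stab_stable zeta zeta' :
  stab zeta (config_of_stable zeta') = (zeta' == zeta)%:R.
Proof.
have := @stab_cvg zeta (config_of_stable zeta').
have h n : iter n sweep (stable_indic zeta) (config_of_stable zeta') = (zeta' == zeta)%:R.
  elim: n => [|n IHn] /=; last by rewrite /sweep foldr_topple_stable.
  by rewrite /stable_indic (inj_eq config_of_stable_inj).
under eq_fun do rewrite h.
by move=> /cvg_unique; apply => //; exact: cvg_cst.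
Qed.

End Abelian.

(** * Absorption probabilities *)

Section Absorption.
Variables (R : realType) (V : finType) (K : V -> V -> R) (lambda kappa : R).
Implicit Types (x y z : V) (eta xi : config V) (f g : config V -> R).
Implicit Types (zeta : stable_config V).
Hypothesis K_ge0 : forall x y, 0 <= K x y.
Hypothesis kappa_gt0 : 0 < kappa.
Hypothesis kappa_le1 : kappa <= 1.
Hypothesis kill_ge : forall x, kappa <= kill_rate K x.
Hypothesis lambda_gt0 : 0 < lambda.

Local Notation tpl := (topple K lambda).
Local Notation law := (instr_law K lambda).

Let kill_ge0 x : 0 <= kill_rate K x.
Proof. exact: le_trans (ltW kappa_gt0) (kill_ge x). Qed.
Let lambda1 := lambda1_gt0 lambda_gt0.
Let law_ge0 x i := instr_law_ge0 K_ge0 kill_ge0 lambda_gt0 x i.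

Definition nparticles eta : nat := \sum_x (if eta x is Some k then k else 1)%N.

Lemma nparticles_upd x (v : option nat) eta :
  (nparticles [ffun z => if z == x then v else eta z]
     + (if eta x is Some k then k else 1)
   = nparticles eta + (if v is Some k then k else 1))%N.
Proof.
rewrite /nparticles (bigD1 x) //= [in RHS](bigD1 x) //= ffunE eqxx.
rewrite (eq_bigr (fun z => if eta z is Some k then k else 1%N)); last first.
  by move=> z /negbTE zx; rewrite ffunE zx.
by rewrite addnAC [RHS]addnAC; congr (_ + _)%N; exact: addnC.
Qed.

Lemma nparticles_add_active x eta : nparticles (add_active x eta) = (nparticles eta).+1.
Proof.
have -> : add_active x eta = [ffun z => if z == x then
    (if eta x is Some k then Some k.+1 else Some 2%N) else eta z].
  by apply/ffunP => z; rewrite !ffunE; case: eqP => // ->.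
apply/eqP; rewrite -(eqn_add2r (if eta x is Some k then k else 1%N)) nparticles_upd.
by case: (eta x) => [k|]; rewrite ?addnS ?addSn //= addn0.
Qed.

Lemma nparticles_remove_active x eta : nactive eta x != 0%N ->
  (nparticles (remove_active x eta)).+1 = nparticles eta.
Proof.
case/nactive_gt0P => k ex.
have -> : remove_active x eta = [ffun z => if z == x then Some k else eta z].
  by apply/ffunP => z; rewrite !ffunE; case: eqP => // ->; rewrite ex.
have := nparticles_upd x (Some k) eta; rewrite ex addnS => h.
by apply/eqP; rewrite -(eqn_add2r k) addSn h.
Qed.

Lemma nparticles_fall_asleep x eta : eta x = Some 1%N ->
  nparticles (fall_asleep x eta) = nparticles eta.
Proof.
move=> ex; have := nparticles_upd x None eta; rewrite ex => h.
by apply/eqP; rewrite -(eqn_add2r 1%N) h.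
Qed.

Lemma nparticles_instr_act x i eta : (nparticles (instr_act x i eta) <= nparticles eta)%N.
Proof.
rewrite /instr_act; case: ifP => // /negbT ax.
case: i => [[y|]|].
- by rewrite nparticles_add_active nparticles_remove_active.
- by rewrite -(nparticles_remove_active ax).
- by case: eqP => // /nparticles_fall_asleep ->.
Qed.

Lemma nparticles_kill x eta : nactive eta x != 0%N ->
  (nparticles (instr_act x (Some None) eta)).+1 = nparticles eta.
Proof. by move=> ax; rewrite /instr_act (negbTE ax) nparticles_remove_active. Qed.

Definition is_stable eta := [forall x, nactive eta x == 0%N].

Lemma is_stableP eta :
  reflect (exists zeta, eta = config_of_stable zeta) (is_stable eta).
Proof.
apply: (iffP forallP) => [h|[zeta ->] x]; last by rewrite nactive_stable.
exists [ffun x => eta x == None]; apply/ffunP => x; rewrite !ffunE.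
by move: (h x); rewrite /nactive; case: (eta x) => [[|k]|].
Qed.

(* Lyapunov function: a toppling decreases it by at least
   [kappa / (1 + lambda)] on average. *)
Definition lyapunov eta : R := if is_stable eta then 0 else (nparticles eta)%:R.

Lemma lyapunov_le eta : lyapunov eta <= (nparticles eta)%:R.
Proof. by rewrite /lyapunov; case: ifP. Qed.

Lemma nparticles_gt0 eta : ~~ is_stable eta -> (0 < nparticles eta)%N.
Proof.
rewrite negb_forall => /existsP[x ax].
by rewrite -(nparticles_remove_active ax).
Qed.

Definition drift : R := kappa / (1 + lambda).

Lemma drift_gt0 : 0 < drift.
Proof. by rewrite divr_gt0. Qed.

Lemma drift_le1 : drift <= 1.
Proof. by rewrite ler_pdivrMr // mul1r (le_trans kappa_le1) // lerDl ltW. Qed.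

Lemma topple_lyapunov x eta : nactive eta x != 0%N ->
  tpl x lyapunov eta <= (nparticles eta)%:R - drift.
Proof.
move=> ax.
apply: (@le_trans _ _ (\sum_i law x i * ((nparticles eta)%:R
    - (if i == Some None then 1 else 0)))).
  apply: ler_sum => i _; rewrite ler_wpM2l ?law_ge0 //.
  apply: le_trans (lyapunov_le _) _; case: eqP => [->|_].
    by rewrite -(nparticles_kill ax) -natr1 addrK.
  by rewrite subr0 ler_nat nparticles_instr_act.
under eq_bigr do rewrite mulrBr.
rewrite sumrB -mulr_suml sum_instr_law // mul1r lerD2l lerN2.
rewrite (bigD1 (Some None)) //= big1 ?addr0 => [|i /negbTE ->]; last exact: mulr0.
by rewrite mulr1 /drift ler_pM2r ?invr_gt0.
Qed.

Variable N : nat.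
Hypothesis N_gt0 : (0 < N)%N.

(** Uniformization: [arw_gen] is [(1 + lambda) * N] times the difference between this operator and
    the identity. With at most [N] particles the weights of the topplings sum to at most 1, and the
    operator is an average. *)
Definition walk_step f eta : R :=
  f eta + \sum_x (nactive eta x)%:R / N%:R * (tpl x f eta - f eta).

Definition contraction : R := 1 - drift / N%:R ^+ 2.

Let N0 : 0 < N%:R :> R. Proof. by rewrite ltr0n. Qed.

Lemma contraction_ge0 : 0 <= contraction.
Proof.
rewrite subr_ge0 ler_pdivrMr ?exprn_gt0 // mul1r (le_trans drift_le1) //.
by rewrite -natrX ler1n expn_gt0 N_gt0.
Qed.

Lemma contraction_lt1 : contraction < 1.
Proof. by rewrite gtrBl divr_gt0 ?drift_gt0 ?exprn_gt0. Qed.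

Lemma sum_nactive_le eta : (\sum_x nactive eta x <= nparticles eta)%N.
Proof.
by apply: leq_sum => x _; rewrite /nactive; case: (eta x) => //=.
Qed.

(** On an unstable configuration, a step topples an active site with total weight at least [1 / N],
    and each such toppling lowers the Lyapunov function by at least [drift] on average. That
    function is at most [N], so its relative decrease is at least [drift / N ^ 2]. *)
Lemma walk_step_contracts (C : R) f :
  (forall eta, (nparticles eta <= N)%N -> `|f eta| <= C * lyapunov eta) ->
  forall eta, (nparticles eta <= N)%N ->
    `|walk_step f eta| <= C * contraction * lyapunov eta.
Proof.
move=> fC eta etaN.
have [st|nst] := boolP (is_stable eta).
  move: (fC _ etaN); rewrite /lyapunov st !mulr0.
  rewrite normr_le0 => /eqP fe; rewrite /walk_step fe add0r big1 ?normr0 //.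
  by move=> x _; move/forallP: st => /(_ x)/eqP ->; rewrite !mul0r.
have t0 := nparticles_gt0 nst.
have fe : `|f eta| <= C * (nparticles eta)%:R.
  by apply: le_trans (fC _ etaN) _; rewrite /lyapunov (negbTE nst).
have C0 : 0 <= C.
  by have := le_trans (normr_ge0 _) fe; rewrite pmulr_lge0 // ltr0n.
have tx x : nactive eta x != 0%N ->
    `|tpl x f eta| <= C * ((nparticles eta)%:R - drift).
  move=> ax; apply: le_trans (ler_norm_sum _ _ _) _.
  apply: le_trans (ler_wpM2l C0 (topple_lyapunov ax)).
  rewrite /topple mulr_sumr; apply: ler_sum => i _.
  rewrite normrM ger0_norm ?law_ge0 // mulrCA ler_wpM2l ?law_ge0 //.
  by apply: fC; apply: leq_trans etaN; exact: nparticles_instr_act.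
set A : R := \sum_x (nactive eta x)%:R / N%:R.
have A1 : A <= 1.
  rewrite /A -mulr_suml ler_pdivrMr // mul1r -natr_sum ler_nat.
  exact: leq_trans (sum_nactive_le eta) etaN.
have A0 : N%:R^-1 <= A.
  rewrite /A -mulr_suml -[leLHS]mul1r ler_wpM2r ?invr_ge0 ?(ltW N0) //.
  rewrite -natr_sum ler1n; move: nst; rewrite negb_forall => /existsP[x ax].
  by rewrite (bigD1 x) //= addn_gt0 lt0n ax.
rewrite /walk_step; under eq_bigr do rewrite mulrBr.
rewrite sumrB -mulr_suml -/A addrCA -[X in _ + (X - _)]mul1r -mulrBl addrC.
apply: le_trans (ler_normD _ _) _.
apply: (@le_trans _ _ ((1 - A) * (C * (nparticles eta)%:R)
   + A * (C * ((nparticles eta)%:R - drift)))).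
  apply: lerD; first by rewrite normrM ger0_norm ?subr_ge0 // ler_wpM2l ?subr_ge0.
  rewrite /A mulr_suml; apply: le_trans (ler_norm_sum _ _ _) _.
  apply: ler_sum => x _; have [->|ax] := eqVneq (nactive eta x) 0%N.
    by rewrite !mul0r normr0.
  by rewrite normrM ger0_norm ?divr_ge0 // ler_wpM2l ?divr_ge0 ?tx.
rewrite /lyapunov (negbTE nst) -mulrA.
rewrite [leLHS](_ : _ = C * ((nparticles eta)%:R - A * drift)); last by ring.
rewrite ler_wpM2l // /contraction mulrBl mul1r lerD2l lerN2.
have -> : drift / N%:R ^+ 2 * (nparticles eta)%:R
    = N%:R^-1 * ((nparticles eta)%:R / N%:R) * drift.
  by rewrite expr2 invfM; ring.
rewrite ler_wpM2r ?(ltW drift_gt0) //; apply: le_trans A0.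
rewrite -[leRHS]mulr1 ler_wpM2l ?invr_ge0 ?(ltW N0) //.
by rewrite ler_pdivrMr // mul1r ler_nat.
Qed.

Lemma iter_walk_step_contracts (C : R) f j :
  (forall eta, (nparticles eta <= N)%N -> `|f eta| <= C * lyapunov eta) ->
  forall eta, (nparticles eta <= N)%N ->
    `|iter j walk_step f eta| <= C * contraction ^+ j * lyapunov eta.
Proof.
move=> fC; elim: j => [|j IHj] eta etaN /=; first by rewrite expr0 mulr1 fC.
by rewrite exprSr mulrA; exact: walk_step_contracts.
Qed.

Lemma walk_step_fixed f : topple_fixed K lambda f -> walk_step f = f.
Proof.
move=> hf; apply/funext => eta; rewrite /walk_step big1 ?addr0 // => x _.
by rewrite hf subrr mulr0.
Qed.

End Absorption.

(** * Cauchy products of exponential type *)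

Section CauchyProduct.
Variable R : realType.
Implicit Types (x y u v : nat -> R).

Definition cauchy_prod x y (k : nat) : R := \sum_(j < k.+1) x (k - j)%N * y j.

Lemma cauchy_prod_triangle x y n :
  series (cauchy_prod x y) n = \sum_(j < n) series x (n - j)%N * y j.
Proof.
elim: n => [|n IHn]; first by rewrite seriesEord /= !big_ord0.
rewrite seriesSr IHn [RHS]big_ord_recr /= subSnn.
have -> : series x 1 = x 0%N by rewrite /series /= big_nat1.
rewrite /cauchy_prod big_ord_recr /= subnn addrA -big_split /=; congr (_ + _).
by apply: eq_bigr => j _; rewrite subSn ?seriesSr ?mulrDl 1?addrC // ltnW.
Qed.

(** Both sides run over the same pairs of indices, those of the square lying outside the triangle,
    and there the terms compare one by one. *)
Lemma cauchy_prod_dist x y u v n :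
  (forall i, `|x i| <= u i) -> (forall i, `|y i| <= v i) ->
  `|series x n * series y n - series (cauchy_prod x y) n|
    <= series u n * series v n - series (cauchy_prod u v) n.
Proof.
move=> xu yv; rewrite !cauchy_prod_triangle.
have E (p q : nat -> R) : series p n * series q n
    - \sum_(j < n) series p (n - j)%N * q j
  = \sum_(j < n) (\sum_(n - j <= i < n) p i) * q j.
  have -> : series q n = \sum_(j < n) q j by rewrite seriesEord.
  rewrite mulr_sumr -sumrB; apply: eq_bigr => j _.
  by rewrite -mulrBl sub_series leq_subr.
rewrite !E; apply: le_trans (ler_norm_sum _ _ _) _.
apply: ler_sum => j _; rewrite normrM ler_pM //.
by apply: le_trans (ler_norm_sum _ _ _) _; exact: ler_sum.
Qed.

Lemma cvg_cauchy_prod x y u v (X Y U W : R) :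
  (forall i, `|x i| <= u i) -> (forall i, `|y i| <= v i) ->
  series x @ \oo --> X -> series y @ \oo --> Y ->
  series u @ \oo --> U -> series v @ \oo --> W ->
  series (cauchy_prod u v) @ \oo --> U * W ->
  series (cauchy_prod x y) @ \oo --> X * Y.
Proof.
move=> xu yv xX yY uU vW uvUW.
have h0 : series u n * series v n - series (cauchy_prod u v) n @[n --> \oo] --> 0.
  by rewrite -(subrr (U * W)); apply: cvgB => //; exact: cvgM.
have h1 : series x n * series y n - series (cauchy_prod x y) n @[n --> \oo] --> 0.
  apply/norm_cvg0P; apply: (squeeze_cvgr _ (cvg_cst 0) h0).
  by near=> n; rewrite normr_ge0 /=; exact: cauchy_prod_dist.
have -> : series (cauchy_prod x y) = fun n => series x n * series y n
    - (series x n * series y n - series (cauchy_prod x y) n).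
  by apply/funext => n; rewrite opprB addrC subrK.
by rewrite -[X * Y]subr0; apply: cvgB => //; exact: cvgM.
Unshelve. all: by end_near. Qed.

Lemma cauchy_prod_exp_coeff (s t : R) :
  cauchy_prod (exp_coeff s) (exp_coeff t) = exp_coeff (s + t).
Proof.
apply/funext => k; rewrite /cauchy_prod /exp_coeff /= exprDn mulr_suml.
apply: eq_bigr => -[j /=]; rewrite ltnS => jk _; rewrite -(mulr_natr _ 'C(k, j)).
have -> : 'C(k, j)%:R = k`!%:R / j`!%:R / (k - j)`!%:R :> R.
  rewrite -(bin_fact jk) !natrM; field.
  by rewrite !pnatr_eq0 -!lt0n !fact_gt0.
field.
by rewrite !pnatr_eq0 -!lt0n !fact_gt0.
Qed.

(* If [b j = Q^j g], then [a k = (Q - 1)^k g], and the series below is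
   [exp (s (Q - 1)) g = exp (- s) exp (s Q) g]. *)
Lemma exp_binomial_transform (b : nat -> R) (C theta s : R) :
  0 <= s -> 0 <= theta -> (forall j, `|b j| <= C * theta ^+ j) ->
  let a k := \sum_(j < k.+1) (-1) ^+ (k - j) *+ 'C(k, j) * b j in
  exists2 l, series (fun k => s ^+ k / k`!%:R * a k) @ \oo --> l
    & `|l| <= C * expR (- (1 - theta) * s).
Proof.
move=> s0 th0 bC a.
set y := fun j => s ^+ j / j`!%:R * b j.
have yv j : `|y j| <= C * exp_coeff (s * theta) j.
  rewrite /y normrM ger0_norm ?divr_ge0 ?exprn_ge0 //.
  rewrite /exp_coeff /= [leRHS](_ : _ = s ^+ j / j`!%:R * (C * theta ^+ j)).
    by rewrite ler_wpM2l ?divr_ge0 ?exprn_ge0.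
  by rewrite exprMn; ring.
have vW : series (fun j => C * exp_coeff (s * theta) j) @ \oo
    --> C * expR (s * theta).
  rewrite (_ : series _ = fun n => C * series (exp_coeff (s * theta)) n).
    exact: cvgMl_tmp (is_cvg_series_exp_coeff _).
  by apply/funext => n; rewrite /series /= mulr_sumr.
have ycvg : cvgn (series y).
  apply: normed_cvg; apply: (@series_le_cvg _ _ (fun j => C * exp_coeff (s * theta) j)).
  - by move=> n; exact: normr_ge0.
  - by move=> n; apply: le_trans (yv n); exact: normr_ge0.
  - by move=> n; exact: yv.
  - by apply/cvg_ex; exists (C * expR (s * theta)).
have -> : (fun k => s ^+ k / k`!%:R * a k) = cauchy_prod (exp_coeff (- s)) y.
  apply/funext => k; rewrite /a mulr_sumr; apply: eq_bigr => -[j /=].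
  rewrite ltnS => jk _; rewrite /exp_coeff /y /=.
  have -> : s ^+ k = s ^+ (k - j) * s ^+ j by rewrite -exprD subnK.
  rewrite (exprNn s) -(mulr_natr _ 'C(k, j)).
  have -> : 'C(k, j)%:R = k`!%:R / j`!%:R / (k - j)`!%:R :> R.
    rewrite -(bin_fact jk) !natrM; field.
    by rewrite !pnatr_eq0 -!lt0n !fact_gt0.
  by field; rewrite !pnatr_eq0 -!lt0n !fact_gt0.
exists (expR (- s) * limn (series y)).
  apply: (@cvg_cauchy_prod _ _ (exp_coeff s) (fun j => C * exp_coeff (s * theta) j)
     _ _ (expR s) (C * expR (s * theta))) => //.
  - move=> i; rewrite /exp_coeff /= normrM normrX normrN (ger0_norm s0) //.
    by rewrite ger0_norm ?invr_ge0.
  - exact: is_cvg_series_exp_coeff.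
  - exact: is_cvg_series_exp_coeff.
  - rewrite mulrCA -expRD.
    rewrite (_ : series _ = fun n => C * series (exp_coeff (s + s * theta)) n).
      exact: cvgMl_tmp (is_cvg_series_exp_coeff _).
    apply/funext => n; rewrite -cauchy_prod_exp_coeff /series /= mulr_sumr.
    apply: eq_bigr => k _; rewrite /cauchy_prod mulr_sumr.
    by apply: eq_bigr => j _; rewrite mulrCA.
have -> : - (1 - theta) * s = - s + s * theta by ring.
rewrite expRD mulrCA normrM ger0_norm ?expR_ge0 // ler_wpM2l ?expR_ge0 //.
apply: (le_trans (lim_series_norm _)).
  apply: (@series_le_cvg _ _ (fun j => C * exp_coeff (s * theta) j)).
  - by move=> n; exact: normr_ge0.
  - by move=> n; apply: le_trans (yv n); exact: normr_ge0.
  - by move=> n; exact: yv.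
  - by apply/cvg_ex; exists (C * expR (s * theta)).
have <- : limn (series (fun j => C * exp_coeff (s * theta) j)) = C * expR (s * theta).
  exact/cvg_lim.
apply: lim_series_le => //.
- apply: (@series_le_cvg _ _ (fun j => C * exp_coeff (s * theta) j)).
  - by move=> n; exact: normr_ge0.
  - by move=> n; apply: le_trans (yv n); exact: normr_ge0.
  - by move=> n; exact: yv.
  - by apply/cvg_ex; exists (C * expR (s * theta)).
- by apply/cvg_ex; exists (C * expR (s * theta)).
Qed.

End CauchyProduct.

(** * Absorption probabilities of the continuous-time dynamics *)

Section AbsorptionProbability.
Variables (R : realType) (V : finType) (K : V -> V -> R) (lambda kappa : R).
Implicit Types (x y z : V) (eta xi : config V) (f g : config V -> R).
Implicit Types (zeta : stable_config V).
Hypothesis K_ge0 : forall x y, 0 <= K x y.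
Hypothesis kappa_gt0 : 0 < kappa.
Hypothesis kappa_le1 : kappa <= 1.
Hypothesis kill_ge : forall x, kappa <= kill_rate K x.
Hypothesis lambda_gt0 : 0 < lambda.

Local Notation tpl := (topple K lambda).
Local Notation law := (instr_law K lambda).
Local Notation gen := (arw_gen K lambda).

Let kill_ge0 x : 0 <= kill_rate K x.
Proof. exact: le_trans (ltW kappa_gt0) (kill_ge x). Qed.
Let lambda1 := lambda1_gt0 lambda_gt0.

Lemma le_lyapunov f (C : R) :
  (forall zeta, f (config_of_stable zeta) = 0) ->
  (forall eta, `|f eta| <= C) -> forall eta, `|f eta| <= C * lyapunov R eta.
Proof.
move=> f0 fC eta; have [st|nst] := boolP (is_stable eta).
  rewrite /lyapunov st mulr0; have /is_stableP[zeta ->] := st.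
  by rewrite f0 normr0.
rewrite /lyapunov (negbTE nst); apply: le_trans (fC eta) _.
have C0 : 0 <= C by apply: le_trans (fC eta).
by rewrite -[leLHS]mulr1 ler_wpM2l // ler1n nparticles_gt0.
Qed.

(** [walk_step] fixes such a function and also contracts it geometrically. Taking [N] above the
    initial number of particles is enough, since this number never increases. *)
Lemma topple_fixed_eq0 f (C : R) : topple_fixed K lambda f ->
  (forall zeta, f (config_of_stable zeta) = 0) ->
  (forall eta, `|f eta| <= C) -> forall eta, f eta = 0.
Proof.
move=> hf f0 fC eta; apply/eqP; rewrite -normr_le0.
set N := (nparticles eta).+1; set th := contraction lambda kappa N.
have h j : `|f eta| <= C * th ^+ j * lyapunov R eta.
  have itf : iter j (walk_step K lambda N) f = f.
    by elim: j => //= j ->; exact: walk_step_fixed.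
  rewrite -{1}itf; apply: iter_walk_step_contracts => // xi _.
  exact: le_lyapunov.
have th0 : 0 <= th by exact: contraction_ge0.
have th1 : th < 1 by exact: contraction_lt1.
have cv : C * th ^+ j * lyapunov R eta @[j --> \oo] --> 0.
  rewrite -(mul0r (lyapunov R eta)) -(mulr0 C).
  by apply: cvgMr_tmp; apply: cvgMl_tmp; apply: cvg_expr; rewrite ger0_norm.
rewrite -(cvg_lim _ cv) //; apply: limr_ge; first by apply/cvg_ex; exists 0.
by near=> j; exact: h.
Unshelve. all: by end_near. Qed.

Lemma arw_genE f eta : gen f eta =
  \sum_x (1 + lambda) * (nactive eta x)%:R * (tpl x f eta - f eta).
Proof.
apply: eq_bigr => x _; have [ax|ax] := eqVneq (nactive eta x) 0%N.
  rewrite ax mulr0 !mul0r addr0 big1 ?add0r => [|y _]; last by rewrite !mul0r.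
  by move: ax; rewrite /nactive; case: (eta x) => [[|k]|] //= _; rewrite mul0r.
have -> : tpl x f eta - f eta = \sum_i law x i * (f (instr_act x i eta) - f eta).
  under eq_bigr do rewrite mulrBr.
  by rewrite sumrB -mulr_suml sum_instr_law // mul1r.
rewrite !big_option /instr_act (negbTE ax) [RHS]mulrDr [X in _ = _ + X]mulrDr.
rewrite [in RHS]mulr_sumr.
rewrite [RHS]addrC [X in _ = X + _]addrC.
have l0 : 1 + lambda != 0 by rewrite gt_eqF.
congr (_ + _ + _).
- by apply: eq_bigr => y _; rewrite /instr_law; field.
- by rewrite /instr_law /kill_rate; field.
- case/nactive_gt0P: ax => k ek; rewrite /nactive ek /instr_law /=.
  case: k ek => [|k] ek /=; first by field.
  by rewrite subrr !(mulr0, mul0r).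
Qed.

Lemma arw_gen_walk_step (N : nat) f eta : (0 < N)%N ->
  gen f eta = (1 + lambda) * N%:R * (walk_step K lambda N f eta - f eta).
Proof.
move=> N0; rewrite arw_genE /walk_step [_ - f eta]addrAC subrr add0r mulr_sumr.
by apply: eq_bigr => x _; field; rewrite pnatr_eq0 -lt0n.
Qed.

Lemma walk_step_sum (N m : nat) (c : 'I_m -> R) (F : 'I_m -> config V -> R) eta :
  walk_step K lambda N (fun xi => \sum_j c j * F j xi) eta
    = \sum_j c j * walk_step K lambda N (F j) eta.
Proof.
rewrite /walk_step; under [RHS]eq_bigr do rewrite mulrDr mulr_sumr.
rewrite big_split /=; congr (_ + _); rewrite exchange_big /=.
apply: eq_bigr => x _; have -> : tpl x (fun xi => \sum_j c j * F j xi) eta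
    = \sum_j c j * tpl x (F j) eta.
  rewrite /topple; under eq_bigr do rewrite mulr_sumr.
  rewrite exchange_big /=; apply: eq_bigr => j _; rewrite mulr_sumr.
  by apply: eq_bigr => i _; rewrite mulrCA.
rewrite -sumrB mulr_sumr; apply: eq_bigr => j _.
by rewrite -mulrBr mulrCA.
Qed.

Lemma iter_arw_gen (N k : nat) f eta : (0 < N)%N ->
  iter k gen f eta = ((1 + lambda) * N%:R) ^+ k *
    \sum_(j < k.+1) (-1) ^+ (k - j) *+ 'C(k, j) * iter j (walk_step K lambda N) f eta.
Proof.
move=> N0; elim: k eta => [|k IHk] eta /=.
  by rewrite big_ord1 expr0 mul1r bin0 mulr1n expr0 mul1r.
set Q := walk_step K lambda N; set c := (1 + lambda) * N%:R.
have -> : iter k gen f = (fun xi => \sum_(j < k.+1)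
    (c ^+ k * ((-1) ^+ (k - j) *+ 'C(k, j))) * iter j Q f xi).
  by apply/funext => xi; rewrite IHk mulr_sumr; apply: eq_bigr => j _; rewrite mulrA.
rewrite (arw_gen_walk_step _ _ N0) -/c walk_step_sum exprS -mulrA /=; congr (_ * _).
under eq_bigr do rewrite -mulrA.
under [X in _ - X]eq_bigr do rewrite -mulrA.
rewrite -!mulr_sumr -mulrBr; congr (_ * _).
rewrite [RHS]big_ord_recl /= [X in _ - X]big_ord_recl /= !bin0 !mulr1n !subn0.
rewrite opprD addrCA exprS mulN1r mulNr; congr (_ + _).
have -> : \sum_(i < k.+1) (-1) ^+ (k.+1 - bump 0 i) *+ 'C(k.+1, bump 0 i) * Q (iter i Q f) eta
  = \sum_(i < k.+1) (-1) ^+ (k - i) *+ 'C(k, i.+1) * Q (iter i Q f) eta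
   + \sum_(i < k.+1) (-1) ^+ (k - i) *+ 'C(k, i) * Q (iter i Q f) eta.
  rewrite -big_split /=; apply: eq_bigr => i _; rewrite /bump /= add1n subSS binS.
  by rewrite mulrnDr mulrDl.
rewrite addrC; congr (_ + _).
rewrite [in RHS]big_ord_recr /= (bin_small (leqnn _)) mulr0n mul0r addr0 -sumrN.
apply: eq_bigr => -[i ik] _ /=; rewrite /bump /= add1n -mulNr -mulNrn; congr (_ *+ _ * _).
by rewrite -(subnSK ik) exprS mulN1r.
Qed.

Lemma stab_le1 zeta eta : stab K lambda zeta eta <= 1.
Proof.
apply: iter_limit_le.
- exact: foldr_topple_mono.
- by move=> xi; apply: foldr_topple_ge => //; exact: subharmonic_indic.
- exact: stable_indic_le1.
- exact: foldr_topple_le1.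
- move=> n xi; apply: iter_le1; first exact: stable_indic_le1.
  exact: foldr_topple_le1.
Qed.

(* [stab zeta] is annihilated by the generator, and the difference with the
   indicator of [zeta] vanishes on the stable configurations, hence is
   contracted by the semigroup. *)
Lemma absorption_probE zeta eta :
  absorption_prob K lambda eta (config_of_stable zeta) = stab K lambda zeta eta.
Proof.
pose N := (nparticles eta).+1; pose Q := walk_step K lambda N.
pose th := contraction lambda kappa N.
pose f := stable_indic R zeta; pose q := stab K lambda zeta.
pose g xi := f xi - q xi.
have qh : topple_fixed K lambda q by exact: stab_fixed.
have g0 zeta' : g (config_of_stable zeta') = 0.
  rewrite /g /f /q /stable_indic stab_stable //.
  by rewrite (inj_eq (@config_of_stable_inj V)) subrr.
have g1 xi : `|g xi| <= 1.
  have h1 : q xi <= 1 by exact: stab_le1.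
  have h2 : 0 <= q xi by exact: stab_ge0.
  have h3 : 0 <= f xi by rewrite /f /stable_indic; case: eqP.
  have h4 : f xi <= 1 by exact: stable_indic_le1.
  by rewrite ler_norml /g; move: (q xi) (f xi) h1 h2 h3 h4 => a b; lra.
have gb j : `|iter j Q g eta| <= lyapunov R eta * th ^+ j.
  rewrite -[X in _ <= X]mul1r mulrA mulrAC.
  apply: iter_walk_step_contracts => // xi _.
  exact: le_lyapunov.
have th0 : 0 <= th by exact: contraction_ge0.
have th1 : th < 1 by exact: contraction_lt1.
pose c := (1 + lambda) * N%:R.
have c0 : 0 < c by rewrite mulr_gt0 // ltr0n.
(* The generator annihilates [q], which therefore contributes only to the term of order 0 of the
   exponential series. *)
have iterf k : iter k gen f eta = iter k gen g eta + (if k == 0%N then q eta else 0).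
  case: k => [|k]; first by rewrite /= /g subrK.
  rewrite !iterSr addr0; congr (iter k _ _ _); apply/funext => xi.
  rewrite !arw_genE; apply: eq_bigr => x _; congr (_ * _).
  have -> : tpl x g xi = tpl x f xi - tpl x q xi.
    by rewrite /topple -sumrB; apply: eq_bigr => i _; rewrite -mulrBr.
  by rewrite qh /g; ring.
have semi t : 0 <= t ->
    `|arw_semigroup K lambda t f eta - q eta|
      <= lyapunov R eta * expR (- (1 - th) * (c * t)).
  move=> t0; have ct0 : 0 <= c * t by rewrite mulr_ge0 // ltW.
  have [l lcvg lle] := exp_binomial_transform ct0 th0 gb.
  suff -> : arw_semigroup K lambda t f eta = l + q eta by rewrite addrK.
  apply/cvg_lim => //.
  have -> : series (fun k => t ^+ k / k`!%:R * iter k gen f eta) =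
    fun n => series (fun k => (c * t) ^+ k / k`!%:R *
       \sum_(j < k.+1) (-1) ^+ (k - j) *+ 'C(k, j) * iter j Q g eta) n
     + series (fun k => if k == 0%N then q eta else 0) n.
    apply/funext => n; rewrite /series /= -big_split /=; apply: eq_bigr => k _.
    rewrite iterf (@iter_arw_gen N) // mulrDr -/c (exprMn k c t); congr (_ + _).
      by rewrite mulrA; congr (_ * _); rewrite mulrC mulrA.
    by case: k => [|k]; rewrite ?expr0 ?fact0 ?divr1 ?mul1r ?mulr0.
  apply: cvgD => //; apply: cvg_near_cst; near=> n.
  have n0 : (0 < n)%N by near: n; exact: nbhs_infty_gt.
  by rewrite /series /= big_ltn // big_nat_cond big1 ?addr0 // => -[].
apply/cvg_lim => //.
apply/subr_cvg0/norm_cvg0P.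
have lim0 : lyapunov R eta * expR (- (1 - th) * (c * t)) @[t --> +oo] --> 0.
  rewrite -(mulr0 (lyapunov R eta)); apply: cvgMl_tmp.
  rewrite (_ : (fun t => _) = (fun u : R => expR (- u)) \o (fun t => ((1 - th) * c) * t)).
    apply: cvg_comp; last exact: cvgr_expR.
    by apply: gt0_cvgMry; rewrite ?mulr_gt0 ?subr_gt0.
  by apply/funext => t /=; rewrite mulNr mulrA.
apply: (squeeze_cvgr _ (cvg_cst 0) lim0).
near=> t; rewrite normr_ge0 /=; apply: semi.
by near: t; exact: nbhs_pinfty_ge.
Unshelve. all: by end_near. Qed.

End AbsorptionProbability.

(** * Expectations after stabilization *)

Section Stabilization.
Variables (R : realType) (V : finType) (K : V -> V -> R) (lambda kappa : R).
Implicit Types (x y : V) (eta xi : config V) (F : config V -> R).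
Implicit Types (zeta : stable_config V) (f : stable_config V -> R).
Hypothesis K_ge0 : forall x y, 0 <= K x y.
Hypothesis kappa_gt0 : 0 < kappa.
Hypothesis kappa_le1 : kappa <= 1.
Hypothesis kill_ge : forall x, kappa <= kill_rate K x.
Hypothesis lambda_gt0 : 0 < lambda.

Local Notation tpl := (topple K lambda).
Local Notation law := (instr_law K lambda).
Local Notation stb := (stab K lambda).

Let kill_ge0 x : 0 <= kill_rate K x.
Proof. exact: le_trans (ltW kappa_gt0) (kill_ge x). Qed.
Let lambda1 := lambda1_gt0 lambda_gt0.
Let stb_ge0 zeta eta : 0 <= stb zeta eta.
Proof. exact: stab_ge0. Qed.

Lemma topple_fixed_eq F F' (C C' : R) :
  topple_fixed K lambda F -> topple_fixed K lambda F' ->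
  (forall eta, `|F eta| <= C) -> (forall eta, `|F' eta| <= C') ->
  (forall zeta, F (config_of_stable zeta) = F' (config_of_stable zeta)) ->
  forall eta, F eta = F' eta.
Proof.
move=> hF hF' FC FC' FF' eta; apply/eqP; rewrite -subr_eq0; apply/eqP.
apply: (@topple_fixed_eq0 _ _ K lambda kappa _ _ _ _ _
  (fun xi => F xi - F' xi) (C + C')) => //.
- move=> x xi; rewrite /= -[in RHS](hF x xi) -[in RHS](hF' x xi) /topple -sumrB.
  by apply: eq_bigr => i _; rewrite mulrBr.
- by move=> zeta; rewrite FF' subrr.
- by move=> xi; apply: le_trans (ler_normB _ _) _; rewrite lerD.
Qed.

Definition stabE f eta : R := \sum_zeta stb zeta eta * f zeta.

Lemma stabE_fixed f : topple_fixed K lambda (stabE f).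
Proof.
move=> x eta; rewrite /topple /stabE; under eq_bigr do rewrite mulr_sumr.
rewrite exchange_big /=; apply: eq_bigr => zeta _.
rewrite -[in RHS](stab_fixed K_ge0 kill_ge0 lambda_gt0 zeta x eta) mulr_suml.
by apply: eq_bigr => i _; rewrite mulrA.
Qed.

Lemma stabE_stable f zeta : stabE f (config_of_stable zeta) = f zeta.
Proof.
rewrite /stabE (bigD1 zeta) //= big1 ?addr0 => [|z zz].
  by rewrite stab_stable // eqxx mul1r.
by rewrite stab_stable // eq_sym (negbTE zz) mul0r.
Qed.

Lemma stabE_bounded f eta : `|stabE f eta| <= \sum_zeta `|f zeta|.
Proof.
apply: le_trans (ler_norm_sum _ _ _) _; apply: ler_sum => z _.
rewrite normrM ger0_norm // ler_piMl //.
exact: (@stab_le1 _ _ _ _ kappa).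
Qed.

Lemma stabE_indic zeta eta : stabE (fun z => (z == zeta)%:R) eta = stb zeta eta.
Proof.
rewrite /stabE (bigD1 zeta) //= big1 ?addr0 ?eqxx ?mulr1 // => z /negbTE ->.
by rewrite mulr0.
Qed.

Lemma sum_stab eta : \sum_zeta stb zeta eta = 1.
Proof.
have -> : \sum_zeta stb zeta eta = stabE (fun=> 1) eta.
  by apply: eq_bigr => z _; rewrite mulr1.
apply: (@topple_fixed_eq _ (fun=> 1) _ 1) => //.
- exact: stabE_fixed.
- by move=> x xi; exact: topple_cst.
- by move=> xi; exact: stabE_bounded.
- by move=> xi; rewrite normr1.
- by move=> z; rewrite stabE_stable.
Qed.

(** Topplings never create particles. *)
Lemma stab_eq0 zeta eta :
  (nparticles eta < nparticles (config_of_stable zeta))%N -> stb zeta eta = 0.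
Proof.
set m := nparticles (config_of_stable zeta).
have main (s : seq V) F : (forall xi, (nparticles xi < m)%N -> F xi = 0) ->
    forall xi, (nparticles xi < m)%N -> foldr tpl F s xi = 0.
  move=> F0; elim: s => //= y s IHs xi xim; rewrite /topple big1 // => i _.
  by rewrite IHs ?mulr0 //; apply: leq_ltn_trans xim; exact: nparticles_instr_act.
move=> em; have h n : iter n (sweep K lambda) (stable_indic R zeta) eta = 0.
  elim: n eta em => [|n IHn] xi xim /=; last exact: main.
  by rewrite /stable_indic; case: eqP xim => // ->; rewrite ltnn.
have := stab_cvg K_ge0 kill_ge0 lambda_gt0 (zeta := zeta) (eta := eta).
under eq_fun do rewrite h.
by move=> /cvg_unique; apply => //; exact: cvg_cst.
Qed.

(** Toppling an inactive site leaves [eta] unchanged; toppling an active one commutes with the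
    addition. Only topplings that are already legal before the addition come into play. *)
Lemma topple_fixed_add F x : topple_fixed K lambda F ->
  topple_fixed K lambda (fun eta => F (add_active x eta)).
Proof.
move=> hF y eta; have [ay|ay] := eqVneq (nactive eta y) 0%N.
  exact: topple_inactive.
rewrite -[RHS](hF y); apply: eq_bigr => i _; by rewrite instr_act_add.
Qed.

(* One of two or more particles sharing a site cannot fall asleep. *)
Lemma topple_fixed_extra F x k eta : topple_fixed K lambda F -> eta x = Some k.+1 ->
  F (add_active x eta)
    = \sum_y K x y * F (add_active y eta) + kill_rate K x * F eta.
Proof.
move=> hF ex; have l0 : 1 + lambda != 0 by rewrite gt_eqF.
have ax : nactive (add_active x eta) x == 0%N = false.
  by rewrite /nactive ffunE eqxx ex.
have := hF x (add_active x eta); rewrite /topple !big_option /instr_act ax.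
rewrite ffunE eqxx ex /= (remove_add_active ex) /instr_law.
have -> : \sum_y K x y / (1 + lambda) * F (add_active y eta)
    = (\sum_y K x y * F (add_active y eta)) / (1 + lambda).
  by rewrite mulr_suml; apply: eq_bigr => y _; rewrite mulrAC.
move: (\sum_y _) (F (add_active x eta)) (F eta) (kill_rate K x) => S a b c h.
have : a * (1 + lambda) = lambda * a + (c * b + S) by rewrite -{1}h; field.
by rewrite mulrDr mulr1 [a * _]mulrC addrC => /addrI ->; rewrite addrC.
Qed.

(** One favourable scenario suffices: each site is toppled once, its particle falling asleep where
    [zeta] has one and being killed elsewhere. In [E s], the sites of [s] are those still to be
    toppled. *)
Lemma stab_gt0 zeta : 0 < stb zeta [ffun _ : V => Some 1%N].
Proof.
have act_pos xi x i : 0 < law x i ->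
    0 < stb zeta (instr_act x i xi) -> 0 < stb zeta xi.
  move=> li h; rewrite -(stab_fixed K_ge0 kill_ge0 lambda_gt0 zeta x xi).
  rewrite /topple (bigD1 i) //= ltr_wpDr //; last exact: mulr_gt0.
  by apply: sumr_ge0 => j _; rewrite mulr_ge0 // instr_law_ge0.
pose E (s : seq V) : config V := [ffun x => if x \in s then Some 1%N
  else if zeta x then None else Some 0%N].
suff pos : forall s : seq V, uniq s -> 0 < stb zeta (E s).
  have -> : [ffun _ : V => Some 1%N] = E (enum V) :> config V.
    by apply/ffunP => x; rewrite !ffunE mem_enum.
  exact: pos (enum_uniq V).
elim=> [_|x s IHs /= /andP[xs us]].
  have -> : E [::] = config_of_stable zeta by apply/ffunP => x; rewrite !ffunE.
  by rewrite stab_stable // eqxx.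
have ax : nactive (E (x :: s)) x == 0%N = false.
  by rewrite /nactive ffunE inE eqxx.
pose i : option (option V) := if zeta x then None else Some None.
apply: (@act_pos _ x i).
  rewrite /i /instr_law; case: (zeta x); rewrite divr_gt0 //.
  exact: lt_le_trans (kill_ge x).
suff -> : instr_act x i (E (x :: s)) = E s by exact: IHs.
rewrite /instr_act ax /i ffunE inE eqxx.
apply/ffunP => y; case zx : (zeta x) => /=; rewrite !ffunE inE;
  case: (y =P x) => [->|] //=; by rewrite (negbTE xs) zx.
Qed.

Variable nu : V -> R.

Definition arw_op f zeta : R :=
  \sum_x nu x * stabE f (add_active x (config_of_stable zeta)).

(** Both sides are bounded, [topple_fixed] and equal on stable configurations. In probabilistic
    terms, the new particle may be added before the stabilization rather than after it. *)
Lemma stabE_arw_op f eta :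
  stabE (arw_op f) eta = \sum_x nu x * stabE f (add_active x eta).
Proof.
apply: (@topple_fixed_eq _ (fun eta => \sum_x nu x * stabE f (add_active x eta)) _
  (\sum_x `|nu x| * \sum_zeta `|f zeta|)).
- exact: stabE_fixed.
- move=> y xi; rewrite /topple; under eq_bigr do rewrite mulr_sumr.
  rewrite exchange_big /=; apply: eq_bigr => x _.
  rewrite -[in RHS](topple_fixed_add x (stabE_fixed f) y xi) mulr_sumr.
  by apply: eq_bigr => i _; rewrite mulrCA.
- by move=> xi; exact: stabE_bounded.
- move=> xi; apply: le_trans (ler_norm_sum _ _ _) _; apply: ler_sum => x _.
  by rewrite normrM ler_wpM2l // stabE_bounded.
- by move=> zeta; rewrite stabE_stable.
Qed.

End Stabilization.

(** * Hitting probabilities and growing sets *)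

Section Hitting.
Variables (R : realType) (V : finType) (K : V -> V -> R).
Implicit Types (x y z : V) (B : {set V}) (u w : V -> R).
Hypothesis K_ge0 : forall x y, 0 <= K x y.
Hypothesis kill_gt0 : forall x, 0 < kill_rate K x.

(** At a positive maximum, which must lie in [B], strict killing makes the [K]-average strictly
    smaller than the maximum. *)
Lemma max_principle B w :
  (forall x, x \in B -> w x <= \sum_y K x y * w y) ->
  (forall x, x \notin B -> w x <= 0) -> forall x, w x <= 0.
Proof.
move=> wB w0 x.
have [m _ mmax] := @Order.TotalTheory.arg_maxP _ _ _ x xpredT w isT.
apply: le_trans (mmax x isT) _; rewrite leNgt; apply/negP => wm.
have mB : m \in B by apply: contraLR wm => /w0; rewrite -leNgt.
have := wB m mB; apply/negP; rewrite -ltNge.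
apply: (@le_lt_trans _ _ (\sum_y K m y * w m)).
  by apply: ler_sum => y _; rewrite ler_wpM2l //; exact: mmax.
rewrite -mulr_suml -[ltRHS]mul1r ltr_pM2r //.
by have := kill_gt0 m; rewrite /kill_rate subr_gt0.
Qed.

Definition hit_step B z u x : R :=
  if x \in B then \sum_y K x y * u y else (x == z)%:R.

(* [hit B z x] is the probability that a [K]-walk started at [x] exits [B]
   at [z]. *)
Definition hit B z : V -> R := iter_limit (hit_step B z) (fun=> 0).

Lemma hit_fixed B z x : hit_step B z (hit B z) x = hit B z x.
Proof.
have K1 y : \sum_x K y x <= 1 by have := ltW (kill_gt0 y); rewrite subr_ge0.
apply: iter_limit_fixed; rewrite {x}/hit_step.
- move=> u v uv x; case: ifP => // _; apply: ler_sum => y _.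
  by rewrite ler_wpM2l.
- move=> u v uv x; case: ifP => _; last exact: cvg_cst.
  apply: cvg_big => [|y _]; first exact: add_continuous.
  by apply: cvgMl_tmp; exact: uv.
- move=> x; case: ifP => // _; first by apply: sumr_ge0 => y _; rewrite mulr0.
- by move=> _; exact: ler01.
- move=> u u1 x; case: ifP => _; last by case: eqP.
  apply: le_trans (K1 x); apply: ler_sum => y _.
  by rewrite ler_piMr.
Qed.

Lemma hit_in B z x : x \in B -> hit B z x = \sum_y K x y * hit B z y.
Proof. by move=> xB; rewrite -[LHS]hit_fixed /hit_step xB. Qed.

Lemma hit_out B z x : x \notin B -> hit B z x = (x == z)%:R.
Proof. by move=> /negbTE xB; rewrite -hit_fixed /hit_step xB. Qed.

Lemma hit_ge0 B z x : 0 <= hit B z x.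
Proof.
rewrite -oppr_le0; apply: (@max_principle B (fun x => - hit B z x)) => y yB.
  by rewrite hit_in // -sumrN; apply: ler_sum => w _; rewrite mulrN.
by rewrite hit_out // oppr_le0.
Qed.

Lemma walk_unique B u w :
  (forall x, x \in B -> u x = \sum_y K x y * u y) ->
  (forall x, x \in B -> w x = \sum_y K x y * w y) ->
  (forall x, x \notin B -> u x = w x) -> forall x, u x = w x.
Proof.
have main f g : (forall x, x \in B -> f x = \sum_y K x y * f y) ->
    (forall x, x \in B -> g x = \sum_y K x y * g y) ->
    (forall x, x \notin B -> f x = g x) -> forall x, f x <= g x.
  move=> fB gB fg x; rewrite -subr_le0.
  apply: (@max_principle B (fun x => f x - g x)) => y yB.
    rewrite fB // gB // -sumrB; apply: ler_sum => z _.
    by rewrite mulrBr.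
  by rewrite fg // subrr.
move=> uB wB uw x; apply/eqP; rewrite eq_le !main // => y /uw //.
Qed.

(* Decomposition according to the fate of the walk: exit [B], or be killed,
   which yields [c]. *)
Lemma hit_solve B u (c : R) :
  (forall x, x \in B -> u x = \sum_y K x y * u y + kill_rate K x * c) ->
  forall x, u x = c + \sum_(z | z \notin B) hit B z x * (u z - c).
Proof.
move=> uB; suff h x : u x - c = \sum_(z | z \notin B) hit B z x * (u z - c).
  by move=> x; rewrite -h addrC subrK.
move: x; apply: (@walk_unique B (fun x => u x - c)) => x xB.
- rewrite uB //; under [RHS]eq_bigr do rewrite mulrBr.
  by rewrite sumrB -mulr_suml /kill_rate; ring.
- under [RHS]eq_bigr do rewrite mulr_sumr.
  rewrite exchange_big /=; apply: eq_bigr => z _.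
  rewrite hit_in // mulr_suml; apply: eq_bigr => y _; by rewrite mulrA.
- rewrite (bigD1 x) //= hit_out // eqxx mul1r big1 ?addr0 // => z /andP[zB zx].
  by rewrite hit_out // eq_sym (negbTE zx) mul0r.
Qed.

Lemma sum_hit_le1 B x : \sum_(z | z \notin B) hit B z x <= 1.
Proof.
rewrite -subr_le0; move: x.
apply: (@max_principle B (fun x => \sum_(z | z \notin B) hit B z x - 1)) => x xB.
  under [leRHS]eq_bigr do rewrite mulrBr mulr1 mulr_sumr.
  rewrite sumrB exchange_big /=; under [X in X - 1 <= _]eq_bigr do rewrite hit_in //.
  rewrite lerD2l lerN2.
  by have := ltW (kill_gt0 x); rewrite subr_ge0.
rewrite (bigD1 x) //= hit_out // eqxx big1 ?addr0 ?subrr // => z /andP[zB zx].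
by rewrite hit_out // eq_sym (negbTE zx).
Qed.

(** Strong Markov property at the exit from [B]: it takes place at [z], or at [y] and the walk
    resumes from there. *)
Lemma hit_setU1 B y z x : y \notin B -> z \notin y |: B ->
  hit (y |: B) z x = hit B z x + hit B y x * hit (y |: B) z y.
Proof.
rewrite in_setU1 negb_or => yB /andP[zy zB]; move: x.
apply: (@walk_unique B _ (fun x => hit B z x + hit B y x * hit (y |: B) z y))
  => x xB.
- by rewrite hit_in // in_setU1 xB orbT.
- under [RHS]eq_bigr do rewrite mulrDr mulrA.
  by rewrite big_split /= -mulr_suml -!hit_in.
- have [->|xy] := eqVneq x y.
    by rewrite !(hit_out _ yB) eqxx mul1r eq_sym (negbTE zy) add0r.
  rewrite [LHS]hit_out ?in_setU1 ?negb_or ?xy // !(hit_out _ xB) (negbTE xy).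
  by rewrite mul0r addr0.
Qed.

(* Reversibility with respect to [w], together with the killing, bounds the
   expected number of visits. *)
Lemma sum_hit_le (w : V -> R) B z : z \notin B ->
  (forall x y, w x * K x y = w y * K y x) ->
  (forall x, 0 <= w x) -> (forall x, 1 <= w x * kill_rate K x) ->
  \sum_x hit B z x <= w z.
Proof.
move=> zB wK w0 w1.
have h : \sum_x w x * hit B z x
    <= \sum_x w x * \sum_y K x y * hit B z y + w z.
  rewrite [leLHS](bigID (mem B)) /= [in leRHS](bigID (mem B)) /=.
  rewrite -addrA; apply: lerD.
    by apply: ler_sum => x xB; rewrite hit_in.
  rewrite (bigD1 z) //= hit_out // eqxx mulr1 big1 ?addr0 => [|x /andP[xB xz]].
    rewrite lerDr; apply: sumr_ge0 => x _; rewrite mulr_ge0 //.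
    by apply: sumr_ge0 => y _; rewrite mulr_ge0 ?hit_ge0.
  by rewrite hit_out // (negbTE xz) mulr0.
have e : \sum_x w x * \sum_y K x y * hit B z y
    = \sum_y w y * hit B z y * (1 - kill_rate K y).
  under eq_bigr do rewrite mulr_sumr.
  rewrite exchange_big /=; apply: eq_bigr => y _.
  rewrite /kill_rate opprB addrC subrK mulr_sumr; apply: eq_bigr => x _.
  by rewrite mulrA wK; ring.
move: h; rewrite e; under [X in _ <= X + _]eq_bigr do rewrite mulrBr mulr1.
rewrite sumrB => h; have {}h : \sum_x w x * hit B z x * kill_rate K x <= w z by lra.
apply: le_trans h; apply: ler_sum => x _.
by rewrite mulrAC -[leLHS]mul1r ler_wpM2r ?hit_ge0.
Qed.

End Hitting.

(** * Filling time of a random growing set *)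

Section Growth.
Variables (R : realType) (V : finType) (a : {set V} -> V -> R).
Variables (b : {set V} -> V -> V -> R) (d : R).
Implicit Types (B : {set V}) (G : {set V} -> R).

Local Notation full := [set: V]%SET.
Local Notation empty := (@finset.set0 V).

Hypothesis V_gt0 : (0 < #|V|)%N.
Hypothesis a_ge : forall B z, z \notin B -> #|V|%:R^-1 <= a B z.
Hypothesis sum_a_le1 : forall B, \sum_(z | z \notin B) a B z <= 1.

Let n : R := #|V|%:R.
Let n_gt0 : 0 < n. Proof. by rewrite ltr0n. Qed.
Let a_gt0 B z : z \notin B -> 0 < a B z.
Proof. by move=> /a_ge; apply: lt_le_trans; rewrite invr_gt0. Qed.

(* A random growing set: [a B z] is the probability that [z] is added to [B]
   at the next step. *)
Definition growth G B : R :=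
  G B + \sum_(z | z \notin B) a B z * (G (z |: B) - G B).

Lemma growth_mono G G' : (forall B, G B <= G' B) ->
  forall B, growth G B <= growth G' B.
Proof.
move=> GG' B; rewrite -subr_ge0.
have -> : growth G' B - growth G B
    = (1 - \sum_(z | z \notin B) a B z) * (G' B - G B)
    + \sum_(z | z \notin B) a B z * (G' (z |: B) - G (z |: B)).
  rewrite /growth mulrBl mul1r mulr_suml opprD addrACA -sumrB -[RHS]addrA.
  congr (_ + _); rewrite -sumrN -big_split /=.
  by apply: eq_bigr => z _; ring.
rewrite addr_ge0 ?mulr_ge0 ?subr_ge0 //.
by apply: sumr_ge0 => z zB; rewrite mulr_ge0 ?subr_ge0 // ltW // a_gt0.
Qed.

Lemma growth_affine (c c' : R) G B :
  growth (fun B => c * G B + c') B = c * growth G B + c'.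
Proof.
rewrite /growth mulrDr mulr_sumr addrAC; congr (_ + _ + _).
by apply: eq_bigr => z _; ring.
Qed.

Lemma growth_setT G : growth G full = G full.
Proof. by rewrite /growth big_pred0 ?addr0 // => z; rewrite finset.in_setT. Qed.

Lemma iter_growth_mono t G G' : (forall B, G B <= G' B) ->
  forall B, iter t growth G B <= iter t growth G' B.
Proof. by move=> GG'; elim: t => //= t IHt; exact: growth_mono. Qed.

Lemma iter_growth_affine t (c c' : R) G B :
  iter t growth (fun B => c * G B + c') B = c * iter t growth G B + c'.
Proof.
elim: t B => //= t IHt B; rewrite -growth_affine; congr (growth _ _).
exact/funext.
Qed.

(** A supermartingale depending on time, with the inequality required only before the horizon [t];
    [surv_tail_left] relies on this restriction. *)
Lemma iter_growth_super t (W : nat -> {set V} -> R) B :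
  (forall j B, (j < t)%N -> growth (W j.+1) B <= W j B) ->
  iter t growth (W t) B <= W 0%N B.
Proof.
elim: t => //= t IHt Wsup; rewrite -iterS iterSr.
apply: le_trans (IHt _); last by move=> j B' jt; apply: Wsup; exact: ltnW.
by apply: iter_growth_mono => B'; exact: Wsup.
Qed.

Definition unfilled B : R := (B != full)%:R.

(* Probability that the set is not full after [t] steps. *)
Definition surv t B : R := iter t growth unfilled B.

Lemma surv_ge0 t B : 0 <= surv t B.
Proof.
apply: (@le_trans _ _ (iter t growth (fun B => 0 * unfilled B + 0) B)).
  by rewrite iter_growth_affine mul0r addr0.
by apply: iter_growth_mono => B'; rewrite mul0r addr0 /unfilled.
Qed.

Lemma surv_le1 t B : surv t B <= 1.
Proof.
apply: (@le_trans _ _ (iter t growth (fun B => 0 * unfilled B + 1) B)).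
  by apply: iter_growth_mono => B'; rewrite mul0r add0r /unfilled; case: eqP.
by rewrite iter_growth_affine mul0r add0r.
Qed.

Lemma card_setCU1 B z : z \notin B -> #|~: B| = #|~: (z |: B)|.+1.
Proof.
move=> zB; have -> : ~: (z |: B) = ~: B :\ z.
  by apply/finset.setP => x; rewrite !inE negb_or.
by rewrite (cardsD1 z) inE zB.
Qed.

Lemma card_setC_gt0 B : (0 < #|~: B|)%N = (B != full).
Proof. by rewrite card_gt0 -(inj_eq (@finset.setC_inj V)) finset.setCK finset.setC0. Qed.

Lemma sum_a_ge B : #|~: B|%:R / n <= \sum_(z | z \notin B) a B z.
Proof.
have -> : #|~: B|%:R / n = \sum_(z | z \notin B) n^-1.
  rewrite sumr_const mulr_natl; congr (_ *+ _).
  by apply: eq_card => z; rewrite !inE.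
by apply: ler_sum => z; exact: a_ge.
Qed.

Lemma sum_a_gt0 B : B != full -> 0 < \sum_(z | z \notin B) a B z.
Proof.
rewrite -card_setC_gt0 => cB; apply: lt_le_trans (sum_a_ge B).
by rewrite divr_gt0 // ltr0n.
Qed.

(** Each missing site is filled with probability at least [1 / n], so the expected number of missing
    sites shrinks by a factor [1 - 1 / n] at each step; Markov's inequality concludes. *)
Lemma surv_le t B : surv t B <= #|~: B|%:R * (1 - n^-1) ^+ t.
Proof.
have n1 : 0 <= 1 - n^-1.
  by rewrite subr_ge0 invf_le1 // ler1n.
pose W j (B : {set V}) : R := (1 - n^-1) ^+ (t - j) * #|~: B|%:R.
rewrite mulrC; have -> : (1 - n^-1) ^+ t * #|~: B|%:R = W 0%N B by rewrite /W subn0.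
apply: le_trans (@iter_growth_super t W B _).
  apply: iter_growth_mono => B'; rewrite /W subnn expr0 mul1r /unfilled.
  by rewrite -card_setC_gt0 ler_nat; case: #|_|.
move=> j {}B jt; rewrite /W.
have -> : growth (fun B => (1 - n^-1) ^+ (t - j.+1) * #|~: B|%:R) B
   = (1 - n^-1) ^+ (t - j.+1) * growth (fun B => #|~: B|%:R) B.
  rewrite -[RHS]addr0 -growth_affine; congr (growth _ B).
  by apply/funext => B'; rewrite addr0.
rewrite -(subnSK jt) exprSr -mulrA ler_wpM2l ?exprn_ge0 //.
rewrite /growth; have -> : \sum_(z | z \notin B)
    a B z * (#|~: (z |: B)|%:R - #|~: B|%:R) = - \sum_(z | z \notin B) a B z.
  rewrite -sumrN; apply: eq_bigr => z zB.
  by rewrite (card_setCU1 zB) -natr1 opprD addrA subrr add0r mulrN1.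
rewrite mulrBl mul1r lerD2l lerN2 mulrC; exact: sum_a_ge.
Qed.

(** The one-step equation solved for the current set: the division eliminates the steps that leave
    it unchanged. The fuel [k] is meant to be the number of missing sites. *)
Fixpoint fill_time_rec k B : R :=
  if k is k'.+1 then
    (1 + \sum_(z | z \notin B) a B z * fill_time_rec k' (z |: B))
      / \sum_(z | z \notin B) a B z
  else 0.

(* Expected number of steps to fill [V] from [B]. *)
Definition fill_time B : R := fill_time_rec #|~: B| B.

Local Notation h := fill_time.

Lemma fill_time_setT : h full = 0.
Proof. by rewrite /fill_time finset.setCT cards0. Qed.

Lemma fill_timeE B : B != full -> h B * \sum_(z | z \notin B) a B z
  = 1 + \sum_(z | z \notin B) a B z * h (z |: B).
Proof.
move=> BT; have A0 := sum_a_gt0 BT; rewrite {1}/fill_time.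
have := BT; rewrite -card_setC_gt0; case cB : #|~: B| => [//|k] _ /=.
rewrite divfK ?gt_eqF //; congr (1 + _); apply: eq_bigr => z zB.
congr (_ * _); rewrite /fill_time; congr (fill_time_rec _ _).
by have := card_setCU1 zB; rewrite cB => -[].
Qed.

Lemma sum_fill_time_drop B : B != full ->
  \sum_(z | z \notin B) a B z * (h B - h (z |: B)) = 1.
Proof.
move=> BT; under eq_bigr do rewrite mulrBr.
by rewrite sumrB -mulr_suml mulrC fill_timeE // addrK.
Qed.

Lemma fill_ind (P : {set V} -> Prop) :
  P full ->
  (forall B, B != full -> (forall z, z \notin B -> P (z |: B)) -> P B) ->
  forall B, P B.
Proof.
move=> PT PI B; have [k] := ubnP #|~: B|; elim: k B => // k IHk B.
have [->|BT] := eqVneq B full; first by [].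
rewrite ltnS => Bk; apply: PI => // z zB; apply: IHk.
by rewrite -(card_setCU1 zB).
Qed.

Definition harmonic_sum (k : nat) : R := \sum_(i < k) i.+1%:R^-1.

(** Coupon collector: with [k + 1] missing sites, one of them is filled with probability at least
    [(k + 1) / n], whence a mean wait of at most [n / (k + 1)]. *)
Lemma fill_time_le B : h B <= n * harmonic_sum #|~: B|.
Proof.
elim/fill_ind: B => [|B BT IH].
  by rewrite fill_time_setT finset.setCT cards0 /harmonic_sum big_ord0 mulr0.
have A0 := sum_a_gt0 BT; rewrite -(ler_pM2r A0) fill_timeE //.
have := BT; rewrite -card_setC_gt0; case cB : #|~: B| => [//|k] _.
rewrite /harmonic_sum big_ord_recr /= -/(harmonic_sum k) mulrDr mulrDl addrC.
apply: lerD.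
  rewrite mulr_sumr; apply: ler_sum => z zB; rewrite mulrC ler_wpM2r ?(ltW (a_gt0 zB)) //.
  by have := IH z zB; have := card_setCU1 zB; rewrite cB => -[<-].
have := sum_a_ge B; rewrite cB => hs.
apply: le_trans (_ : n / k.+1%:R * (k.+1%:R / n) <= _).
  rewrite [leRHS](_ : _ = 1) //; field.
  by rewrite (gt_eqF n_gt0) /=; rewrite addrC natr1 pnatr_eq0.
by rewrite ler_wpM2l // divr_ge0 // ltW.
Qed.

Hypothesis d_gt0 : 0 < d.
Hypothesis a_le : forall B z, z \notin B -> a B z <= d / n.

Lemma fill_time_ge B : n / d * harmonic_sum #|~: B| <= h B.
Proof.
have nd : 0 < n / d by rewrite divr_gt0.
elim/fill_ind: B => [|B BT IH].
  by rewrite fill_time_setT finset.setCT cards0 /harmonic_sum big_ord0 mulr0.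
have A0 := sum_a_gt0 BT; rewrite -(ler_pM2r A0) fill_timeE //.
have := BT; rewrite -card_setC_gt0; case cB : #|~: B| => [//|k] _.
rewrite /harmonic_sum big_ord_recr /= -/(harmonic_sum k) mulrDr mulrDl addrC.
apply: lerD; last first.
  rewrite mulr_sumr; apply: ler_sum => z zB; rewrite mulrC ler_wpM2l ?(ltW (a_gt0 zB)) //.
  by have := IH z zB; have := card_setCU1 zB; rewrite cB => -[<-].
have hs : \sum_(z | z \notin B) a B z <= k.+1%:R * (d / n).
  have -> : k.+1%:R * (d / n) = \sum_(z | z \notin B) d / n.
    rewrite sumr_const mulr_natl -cB; congr (_ *+ _).
    by apply: eq_card => z; rewrite !inE.
  by apply: ler_sum => z; exact: a_le.
apply: (@le_trans _ _ (n / d / k.+1%:R * (k.+1%:R * (d / n)))).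
  by rewrite ler_wpM2l // divr_ge0 // ltW.
rewrite [leLHS](_ : _ = 1) //; field.
by rewrite (gt_eqF n_gt0) (gt_eqF d_gt0) /=; rewrite addrC natr1 pnatr_eq0.
Qed.

Hypothesis b_ge0 : forall B y z, 0 <= b B y z.
Hypothesis sum_b_le1 : forall B y, \sum_(z | z \notin B) b B y z <= 1.
Hypothesis a_setU1 : forall B y z, y \notin B -> z \notin y |: B ->
  a (y |: B) z = a B z + a B y * b (y |: B) y z.

(* The processes started from [B] and from [y |: B] can be coupled so as to
   differ by at most one site until the second one is full. *)
Lemma fill_time_drop B y : y \notin B -> 0 <= h B - h (y |: B) <= n.
Proof.
move: y; elim/fill_ind: B => [y|B BT IH y yB]; first by rewrite finset.in_setT.
have A0 := sum_a_gt0 BT.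
have eB := sum_fill_time_drop BT.
rewrite (bigD1 y) //= in eB.
have PE z : (z \notin B) && (z != y) = (z \notin y |: B).
  by rewrite finset.in_setU1 negb_or andbC.
rewrite (eq_bigl _ _ PE) in eB.
(* With a single missing site, the expected wait is the inverse of [a B y >= 1 / n]: this is where
   the bound [n] comes from. *)
have [B'T|B'T] := eqVneq (y |: B) full.
  move: eB; rewrite B'T big_pred0 => [|z]; last by rewrite finset.in_setT.
  rewrite addr0 fill_time_setT subr0 => e.
  have a0 := a_gt0 yB; have -> : h B = (a B y)^-1.
    by apply: (mulfI (lt0r_neq0 a0)); rewrite e mulfV ?gt_eqF.
  by rewrite invr_ge0 ltW //= invf_ple ?posrE // a_ge.
have eB' := sum_fill_time_drop B'T.
(* One step of the coupling. A particle settling at [z] in both sets leaves them one site apart. A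
   particle settling at [y] in the smaller set goes on in the larger one, where it settles at [z]
   with probability [b (y |: B) y z], or is killed, and then the sets coincide. The difference is
   thus an average of later ones, with weights of sum at most 1 after division. *)
have main : (h B - h (y |: B)) * \sum_(z | z \notin B) a B z
   = \sum_(z | z \notin y |: B) a B z * (h (z |: B) - h (y |: (z |: B)))
   + a B y * \sum_(z | z \notin y |: B) b (y |: B) y z * (h (y |: B) - h (z |: (y |: B))).
  rewrite (bigD1 y) //= (eq_bigl _ _ PE) mulrDr mulr_sumr.
  have e3 : \sum_(z | z \notin y |: B) a (y |: B) z * (h (y |: B) - h (z |: (y |: B)))
    = \sum_(z | z \notin y |: B) a B z * (h (y |: B) - h (z |: (y |: B)))
    + a B y * \sum_(z | z \notin y |: B) b (y |: B) y z * (h (y |: B) - h (z |: (y |: B))).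
    rewrite mulr_sumr -big_split /=; apply: eq_bigr => z zB.
    by rewrite a_setU1 // mulrDl mulrA.
  have -> : \sum_(z | z \notin y |: B) (h B - h (y |: B)) * a B z
    = \sum_(z | z \notin y |: B) a B z * (h B - h (z |: B))
     - \sum_(z | z \notin y |: B) a B z * (h (y |: B) - h (z |: (y |: B)))
     + \sum_(z | z \notin y |: B) a B z * (h (z |: B) - h (y |: (z |: B))).
    rewrite -sumrB -big_split /=; apply: eq_bigr => z _.
    by rewrite finset.setUCA; ring.
  move: e3 eB; rewrite eB'.
  set s1 := \sum_(z | _) _; set s2 := \sum_(z | _) _; set s3 := \sum_(z | _) _.
  set s4 := \sum_(z | _) _; rewrite [(h B - _) * a B y]mulrC => e3 eB; lra.
have yB' z : z \notin y |: B -> y \notin z |: B.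
  by rewrite !finset.in_setU1 !negb_or => /andP[zy _]; rewrite eq_sym zy.
have zB z : z \notin y |: B -> z \notin B by rewrite finset.in_setU1 negb_or => /andP[].
apply/andP; split.
  rewrite -(pmulr_lge0 _ A0) main addr_ge0 ?mulr_ge0 ?(ltW (a_gt0 yB)) //.
    apply: sumr_ge0 => z zB'; rewrite mulr_ge0 ?(ltW (a_gt0 (zB _ zB'))) //.
    by case/andP: (IH z (zB _ zB') y (yB' _ zB')).
  apply: sumr_ge0 => z zB'; rewrite mulr_ge0 //.
  by case/andP: (IH y yB z zB').
rewrite -(ler_pM2r A0) main [X in _ <= n * X](bigD1 y) //= (eq_bigl _ _ PE).
rewrite mulrDr addrC.
apply: lerD.
  rewrite mulrC ler_wpM2r ?(ltW (a_gt0 yB)) //.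
  apply: (@le_trans _ _ (\sum_(z | z \notin y |: B) b (y |: B) y z * n)).
    apply: ler_sum => z zB'; rewrite ler_wpM2l //.
    by case/andP: (IH y yB z zB').
  by rewrite -mulr_suml ler_piMl // ltW.
rewrite mulr_sumr; apply: ler_sum => z zB'.
rewrite mulrC ler_wpM2r ?(ltW (a_gt0 (zB _ zB'))) //.
by case/andP: (IH z (zB _ zB') y (yB' _ zB')).
Qed.

Lemma fill_time_ge0 B : 0 <= h B.
Proof.
elim/fill_ind: B => [|B BT IH]; first by rewrite fill_time_setT.
have := BT; rewrite -card_setC_gt0 card_gt0 => /finset.set0Pn[y]; rewrite inE => yB.
have /andP[+ _] := fill_time_drop yB.
by rewrite subr_ge0; apply: le_trans; exact: IH.
Qed.

Let m := h empty.

(* [(j + h B - m)^2 + n h B] is a supermartingale: the variance of the filling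
   time is at most [n] times its expectation [m]. *)
Definition cheb (j : nat) B : R := (j%:R + h B - m) ^+ 2 + n * h B.

Lemma growth_cheb j B : B != full -> growth (cheb j.+1) B <= cheb j B.
Proof.
move=> BT; set q := j%:R + h B - m.
have e := sum_fill_time_drop BT.
have : \sum_(z | z \notin B) a B z * (cheb j.+1 (z |: B) - cheb j.+1 B)
   <= \sum_(z | z \notin B) (- 2 * (q + 1)) * (a B z * (h B - h (z |: B))).
  apply: ler_sum => z zB; rewrite mulrCA ler_wpM2l ?(ltW (a_gt0 zB)) //.
  have /andP[D0 Dn] := fill_time_drop zB.
  (* The drop lies between 0 and [n], so the term [n * h] of [cheb] pays for the square of the
     jump. *)
  have : (h B - h (z |: B)) ^+ 2 <= n * (h B - h (z |: B)).
    by rewrite expr2 ler_wpM2r.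
  rewrite /cheb /q -natr1; move: (h B) (h (z |: B)) => p r; lra.
rewrite -mulr_sumr e mulr1 /growth => le.
apply: le_trans (lerD (lexx _) le) _.
rewrite /cheb -natr1 -/q.
have -> : j%:R + 1 + h B - m = q + 1 by rewrite /q; ring.
lra.
Qed.

Lemma cheb_setT_ge j : (j%:R - m) ^+ 2 <= cheb j full.
Proof. by rewrite /cheb fill_time_setT mulr0 !addr0. Qed.

Let set0T : empty != full.
Proof. by rewrite -card_setC_gt0 finset.setC0 cardsT. Qed.

Lemma surv_tail_right t : m <= t%:R ->
  surv t empty * (t%:R - m) ^+ 2 <= n * m.
Proof.
(* Time keeps running once the set is full, so [cheb] is stopped there, at the value 0. On a set
   still unfilled at time [t], it is at least [(t - m) ^ 2] because [h] is nonnegative. *)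
move=> mt; pose W j B := if B == full then 0 else cheb j B.
have -> : n * m = W 0%N empty.
  by rewrite /W (negbTE set0T) /cheb -/m add0r subrr expr0n add0r.
apply: le_trans (@iter_growth_super t W empty _).
  rewrite mulrC -[X in X <= _]addr0 -iter_growth_affine.
  apply: iter_growth_mono => B; rewrite addr0 /W /unfilled.
  case: eqP => _; first by rewrite mulr0.
  rewrite mulr1 /cheb ler_wpDr ?mulr_ge0 ?fill_time_ge0 ?(ltW n_gt0) //.
  by have hB := fill_time_ge0 B; rewrite lerXn2r ?nnegrE; lra.
move=> j B _; have [->|BT] := eqVneq B full.
  by rewrite growth_setT /W eqxx.
rewrite {2}/W (negbTE BT); apply: le_trans (growth_cheb j BT).
apply: growth_mono => B'; rewrite /W; case: eqP => // ->.
by apply: le_trans (cheb_setT_ge _); exact: sqr_ge0.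
Qed.

Lemma surv_tail_left t : t%:R <= m ->
  (1 - surv t empty) * (m - t%:R) ^+ 2 <= n * m.
Proof.
(* The stopped value is now [(m - t) ^ 2]: for a set filled at a time [j <= t <= m], [cheb] is at
   least [(m - j) ^ 2], which is no smaller. *)
move=> tm; pose W j B := if B == full then (m - t%:R) ^+ 2 else cheb j B.
have -> : n * m = W 0%N empty.
  by rewrite /W (negbTE set0T) /cheb -/m add0r subrr expr0n add0r.
apply: le_trans (@iter_growth_super t W empty _).
  rewrite (_ : _ * _ = - (m - t%:R) ^+ 2 * surv t empty + (m - t%:R) ^+ 2);
    last by ring.
  rewrite -iter_growth_affine; apply: iter_growth_mono => B; rewrite /W /unfilled.
  case: eqP => _; first by rewrite mulr0 add0r.
  rewrite mulr1 addNr /cheb addr_ge0 ?sqr_ge0 ?mulr_ge0 ?fill_time_ge0 ?(ltW n_gt0) //.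
move=> j B jt; have [->|BT] := eqVneq B full.
  by rewrite growth_setT /W eqxx.
rewrite {2}/W (negbTE BT); apply: le_trans (growth_cheb j BT).
apply: growth_mono => B'; rewrite /W; case: eqP => // ->.
apply: le_trans (cheb_setT_ge _); rewrite -[leRHS]sqrrN opprB.
have : j.+1%:R <= t%:R :> R by rewrite ler_nat.
by move=> jt'; rewrite lerXn2r ?nnegrE; lra.
Qed.

End Growth.

(** * Relaxation and separation from a minorization *)

Section Doeblin.
Variables (R : realType) (m : nat) (P : 'M[R]_m) (p : 'rV[R]_m).
Variables (s : nat -> R) (C r : R).
Hypothesis P_sum1 : forall i, \sum_j P i j = 1.
Hypothesis p_inv : is_invariant_law P p.
Hypothesis P_ge : forall t i j, (1 - s t) * p 0 j <= (P ^+ t) i j.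
Hypothesis r_ge0 : 0 <= r.
Hypothesis r_lt1 : r < 1.
Hypothesis s_le : forall t, s t <= C * r ^+ t.

Local Notation toC := (real_complex R).
Local Notation PC := (map_mx toC P).
Local Notation normc := Normc.normc.

Lemma normc_sum (I : Type) (l : seq I) (F : I -> R[i]) :
  normc (\sum_(i <- l) F i) <= \sum_(i <- l) normc (F i).
Proof.
elim: l => [|i l IHl]; first by rewrite !big_nil Normc.normc0.
rewrite !big_cons; apply: le_trans (le_normcD _ _) _.
by rewrite lerD2l.
Qed.

Lemma normc_ge0 (z : R[i]) : 0 <= normc z.
Proof. by case: z => a b; exact: sqrtr_ge0. Qed.

Lemma normc_real (x : R) : normc (toC x) = `|x|.
Proof. by rewrite /= expr0n /= addr0 sqrtr_sqr. Qed.

Lemma normcX (z : R[i]) t : normc (z ^+ t) = normc z ^+ t.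
Proof.
elim: t => [|t IHt]; first by rewrite !expr0 Normc.normc1.
by rewrite !exprS Normc.normcM IHt.
Qed.

Lemma sum_expmx t i : \sum_j (P ^+ t) i j = 1.
Proof.
elim: t i => [|t IHt] i.
  rewrite expr0 (bigD1 i) //= mxE eqxx big1 ?addr0 // => j ji.
  by rewrite mxE eq_sym (negbTE ji).
rewrite exprS; under eq_bigr do rewrite mxE.
rewrite exchange_big /=; under eq_bigr do rewrite -mulr_sumr IHt mulr1.
exact: P_sum1.
Qed.

Let p_sum1 : \sum_j p 0 j = 1. Proof. by case: p_inv. Qed.

Lemma map_toC_expmx t : map_mx toC (P ^+ t) = PC ^+ t.
Proof.
elim: t => [|t IHt]; first by rewrite !expr0; exact: map_mx1.
by rewrite !exprS -IHt; exact: map_mxM.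
Qed.

(** The rows of [P ^ t] share the part [(1 - s t) * p], which contributes nothing against a vector
    of sum 0; the remainder is nonnegative with row sums [s t]. *)
Lemma l1_contraction (v : 'rV[R[i]]_m) t : \sum_j v 0 j = 0 ->
  \sum_j normc ((v *m PC ^+ t) 0 j) <= s t * \sum_j normc (v 0 j).
Proof.
move=> v0; have e j : (v *m PC ^+ t) 0 j
    = \sum_i v 0 i * toC ((P ^+ t) i j - (1 - s t) * p 0 j).
  rewrite mxE -map_toC_expmx.
  under [RHS]eq_bigr do rewrite rmorphB mulrBr.
  rewrite sumrB -mulr_suml v0 mul0r subr0.
  by apply: eq_bigr => i _; rewrite mxE.
under eq_bigr do rewrite e.
apply: (@le_trans _ _ (\sum_j \sum_i normc (v 0 i)
    * ((P ^+ t) i j - (1 - s t) * p 0 j))).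
  apply: ler_sum => j _; apply: le_trans (normc_sum _ _) _.
  apply: ler_sum => i _; rewrite Normc.normcM normc_real.
  by rewrite ger0_norm // subr_ge0.
rewrite exchange_big /= mulr_sumr; apply: ler_sum => i _.
rewrite -mulr_sumr sumrB -mulr_sumr sum_expmx p_sum1 mulr1 opprB addrC subrK.
by rewrite mulrC.
Qed.

Lemma l1_gt0 (v : 'rV[R[i]]_m) : v != 0 -> 0 < \sum_j normc (v 0 j).
Proof.
move=> v0; rewrite lt_neqAle sumr_ge0 ?andbT => [|j _]; last exact: normc_ge0.
apply: contraNneq v0 => e; apply/eqP/rowP => j; rewrite mxE.
apply: Normc.eq0_normc; apply/eqP; rewrite eq_le normc_ge0 andbT e.
rewrite (bigD1 j) //= lerDl; apply: sumr_ge0 => k _; exact: normc_ge0.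
Qed.

Lemma le_of_expr_le (x : R) : (forall t, x ^+ t <= C * r ^+ t) -> x <= r.
Proof.
move=> xr; rewrite leNgt; apply/negP => rx.
have x0 : 0 < x by exact: le_lt_trans rx.
have h t : 1 <= C * (r / x) ^+ t.
  by rewrite expr_div_n mulrA ler_pdivlMr ?exprn_gt0 // mul1r.
have cv : C * (r / x) ^+ t @[t --> \oo] --> C * 0.
  apply: cvgMl_tmp; apply: cvg_expr; rewrite ger0_norm ?divr_ge0 // ?(ltW x0) //.
  by rewrite ltr_pdivrMr // mul1r.
rewrite mulr0 in cv.
have : 1 <= (0 : R).
  rewrite -(cvg_lim _ cv) //; apply: limr_ge; first by apply/cvg_ex; exists 0.
  by near=> t; exact: h.
by rewrite ler10.
Unshelve. all: by end_near. Qed.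

Lemma eigenvalue_normc_le z : z != 1 -> eigenvalue PC z -> normc z <= r.
Proof.
move=> z1 /eigenvalueP[v vz v0].
(* A stochastic matrix preserves the sum of a row vector, so an eigenvalue other than 1 forces this
   sum to vanish. *)
have sv : \sum_j v 0 j = 0.
  have : \sum_j (v *m PC) 0 j = \sum_j v 0 j.
    under eq_bigr do rewrite mxE.
    rewrite exchange_big /=; apply: eq_bigr => i _.
    under eq_bigr do rewrite mxE.
    by rewrite -mulr_sumr -rmorph_sum /= P_sum1 mulr1.
  rewrite vz; under eq_bigr do rewrite mxE.
  rewrite -mulr_sumr => /eqP; rewrite -subr_eq0 -{2}[\sum_j _]mul1r -mulrBl.
  by rewrite mulf_eq0 subr_eq0 (negbTE z1) => /eqP.
have vzt t : v *m PC ^+ t = z ^+ t *: v.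
  elim: t => [|t IHt]; first by rewrite !expr0 mulmx1 scale1r.
  by rewrite exprSr mulmxA IHt -scalemxAl vz scalerA -exprSr.
apply: le_of_expr_le => t; apply: le_trans (s_le t).
rewrite -(ler_pM2r (l1_gt0 v0)); apply: le_trans (l1_contraction t sv).
rewrite vzt mulr_sumr; apply: ler_sum => j _.
by rewrite mxE Normc.normcM normcX.
Qed.

Lemma invariant_lawE : invariant_law P = p.
Proof.
apply: xget_unique => // q [q0 q1 qP]; apply/eqP; rewrite -subr_eq0.
apply: contraT => qp0.
pose v := map_mx toC (q - p).
have vE j : v 0 j = toC (q 0 j - p 0 j) by rewrite !mxE.
have v0 : v != 0.
  apply: contraNneq qp0 => e; apply/eqP/rowP => j.
  have /(congr1 (fun M : 'rV_m => M 0 j)) := e.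
  by rewrite vE !mxE -(rmorph0 toC) => /complexI.
have sv : \sum_j v 0 j = 0.
  under eq_bigr do rewrite vE.
  by rewrite -rmorph_sum /= sumrB q1 p_sum1 subrr.
have vP t : v *m PC ^+ t = v.
  elim: t => [|t IHt]; first by rewrite expr0 mulmx1.
  have [_ _ pP] := p_inv.
  by rewrite exprSr mulmxA IHt -map_mxM mulmxBl qP pP.
have : 1 <= r.
  apply: le_of_expr_le => t; rewrite expr1n; apply: le_trans (s_le t).
  rewrite -(ler_pM2r (l1_gt0 v0)) mul1r; apply: le_trans (l1_contraction t sv).
  by rewrite vP.
by rewrite leNgt r_lt1.
Qed.

Hypothesis p_gt0 : forall j, 0 < p 0 j.
Variables i0 j0 : 'I_m.
Hypothesis P_eq : forall t, (P ^+ t) i0 j0 = (1 - s t) * p 0 j0.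

Lemma dsepE t : dsep P t = s t.
Proof.
rewrite /dsep invariant_lawE.
set E := [set _ | _ in _].
have ubE x : E x -> x <= s t.
  by case=> ij _ <-; rewrite lerBlDl -lerBlDr ler_pdivlMr.
have Es : E (s t).
  by exists (i0, j0) => //=; rewrite P_eq mulfK ?gt_eqF // opprB addrC subrK.
apply/eqP; rewrite eq_le; apply/andP; split.
  by apply: ge_sup; [exists (s t)|move=> x /ubE].
by apply: ub_le_sup => //; exists (s t) => x /ubE.
Qed.

Lemma trel_bounds (rho0 : R) z : z != 1 -> eigenvalue PC z -> normc z = rho0 ->
  (1 - rho0)^-1 <= trel P <= (1 - r)^-1.
Proof.
move=> z1 ez zr; rewrite /trel /spectral_rho.
set E := [set _ | _ in _].
have ubE x : E x -> x <= r.
  by case=> z' /= [z1' ez'] <-; exact: eigenvalue_normc_le.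
have Er : E rho0 by exists z.
have h1 : rho0 <= sup E by apply: ub_le_sup => //; exists r => x /ubE.
have h2 : sup E <= r by apply: ge_sup; [exists rho0|move=> x /ubE].
have h3 : sup E < 1 by exact: le_lt_trans r_lt1.
have h4 : rho0 < 1 by exact: le_lt_trans h3.
by apply/andP; split; rewrite lef_pV2 ?posrE ?subr_gt0 ?lerD2l ?lerN2.
Qed.

End Doeblin.

(** * The driven chain *)

Section UniformDriving.
Variables (R : realType) (V : finType) (K : V -> V -> R) (lambda kappa : R).
Variables (w : V -> R) (d : R).
Implicit Types (x y z : V) (eta : config V) (A B : {set V}).
Implicit Types (zeta : stable_config V) (f : stable_config V -> R).
Hypothesis V_gt0 : (0 < #|V|)%N.
Hypothesis K_ge0 : forall x y, 0 <= K x y.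
Hypothesis kappa_gt0 : 0 < kappa.
Hypothesis kappa_le1 : kappa <= 1.
Hypothesis kill_ge : forall x, kappa <= kill_rate K x.
Hypothesis lambda_gt0 : 0 < lambda.
Hypothesis w_reversible : forall x y, w x * K x y = w y * K y x.
Hypothesis w_ge0 : forall x, 0 <= w x.
Hypothesis w_le : forall x, w x <= d.
Hypothesis w_kill : forall x, 1 <= w x * kill_rate K x.

Local Notation full := [set: V]%SET.
Local Notation empty := (@finset.set0 V).
Local Notation stb := (stab K lambda).
Local Notation H := (stabE K lambda).
Local Notation nu := (@uniform_law R V).
Local Notation op := (arw_op K lambda nu).
Local Notation P := (arw_mx K lambda nu).
Let n : R := #|V|%:R.
Let n_gt0 : 0 < n. Proof. by rewrite ltr0n. Qed.
Let kill_gt0 x : 0 < kill_rate K x.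
Proof. exact: lt_le_trans (kill_ge x). Qed.
Let kill_ge0 x : 0 <= kill_rate K x.
Proof. exact: ltW. Qed.
Let stb_ge0 zeta eta : 0 <= stb zeta eta.
Proof. exact: stab_ge0. Qed.

Let H_fixed f : topple_fixed K lambda (H f).
Proof. exact: (stabE_fixed K_ge0 kappa_gt0 kill_ge lambda_gt0). Qed.
Let sum_nu : \sum_x nu x = 1.
Proof. by rewrite sumr_const -(mulr_natr #|V|%:R^-1) mulVf // gt_eqF. Qed.

(* When the sites of [B] are occupied, [fill B z] is the probability that the
   next particle, if it walks until it finds an empty site, settles at [z]. *)
Definition fill B z : R := \sum_x nu x * hit K B z x.

Lemma fillE B z : fill B z = n^-1 * \sum_x hit K B z x.
Proof. by rewrite /fill -mulr_sumr. Qed.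

Lemma fill_ge B z : z \notin B -> n^-1 <= fill B z.
Proof.
move=> zB; rewrite fillE -[leLHS]mulr1 ler_wpM2l ?invr_ge0 ?(ltW n_gt0) //.
rewrite (bigD1 z) //= hit_out // eqxx lerDl; apply: sumr_ge0 => x _.
exact: hit_ge0.
Qed.

Lemma sum_fill_le1 B : \sum_(z | z \notin B) fill B z <= 1.
Proof.
rewrite /fill exchange_big /=; under eq_bigr do rewrite -mulr_sumr.
apply: (@le_trans _ _ (\sum_(x : V) nu x * 1)).
  apply: ler_sum => x _; rewrite ler_wpM2l ?invr_ge0 ?(ltW n_gt0) //.
  exact: sum_hit_le1.
by rewrite -mulr_suml sum_nu mul1r.
Qed.

Lemma fill_le B z : z \notin B -> fill B z <= d / n.
Proof.
move=> zB; rewrite fillE mulrC ler_wpM2r ?invr_ge0 ?(ltW n_gt0) //.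
by apply: le_trans (w_le z); exact: sum_hit_le.
Qed.

Lemma fill_setU1 B y z : y \notin B -> z \notin y |: B ->
  fill (y |: B) z = fill B z + fill B y * hit K (y |: B) z y.
Proof.
move=> yB zB; rewrite /fill mulr_suml -big_split /=; apply: eq_bigr => x _.
by rewrite hit_setU1 // mulrDr mulrA.
Qed.

(* The sleeping particles of [zeta], together with one active particle on each
   site of [A]. *)
Definition pile zeta A : config V :=
  [ffun x => if x \in A then Some (if zeta x then 2 else 1)%N
             else if zeta x then None else Some 0%N].

Lemma pile_set0 zeta : pile zeta empty = config_of_stable zeta.
Proof. by apply/ffunP => x; rewrite !ffunE finset.in_set0. Qed.

Lemma add_pile zeta A x : x \notin A ->
  add_active x (pile zeta A) = pile zeta (x |: A).
Proof.
move=> xA; apply/ffunP => y; rewrite !ffunE finset.in_setU1.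
by case: (y =P x) => [->|] //=; rewrite (negbTE xA); case: (zeta x).
Qed.

(* Only the particles of [A] and the new ones are moved, and only while they
   share a site. *)
Lemma stabE_op_pile f zeta A :
  H (op f) (pile zeta A) = growth fill (fun A => H f (pile zeta A)) A.
Proof.
rewrite (@stabE_arw_op _ _ _ _ kappa) //.
have h := @hit_solve _ _ K K_ge0 kill_gt0 A
  (fun x => H f (add_active x (pile zeta A))) (H f (pile zeta A)).
have {}h x : H f (add_active x (pile zeta A)) = H f (pile zeta A)
    + \sum_(z | z \notin A) hit K A z x
      * (H f (pile zeta (z |: A)) - H f (pile zeta A)).
  rewrite h => [|y yA].
    by congr (_ + _); apply: eq_bigr => z zA; rewrite add_pile.
  apply: (topple_fixed_extra lambda_gt0 (k := if zeta y then 1 else 0)%N).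
    exact: H_fixed.
  by rewrite ffunE yA; case: (zeta y).
under eq_bigr do rewrite h mulrDr.
rewrite big_split /= -mulr_suml sum_nu mul1r.
congr (_ + _); under eq_bigr do rewrite mulr_sumr.
rewrite exchange_big /=; apply: eq_bigr => z _; rewrite /fill mulr_suml.
by apply: eq_bigr => x _; rewrite mulrA.
Qed.

Lemma stabE_iter_op_pile t f zeta A :
  H (iter t op f) (pile zeta A)
    = iter t (growth fill) (fun A => H f (pile zeta A)) A.
Proof.
elim: t A => //= t IHt A; rewrite stabE_op_pile; congr (growth _ _ _).
exact/funext.
Qed.

Definition ones : config V := [ffun=> Some 1%N].

Lemma pile_false : pile [ffun=> false] full = ones.
Proof. by apply/ffunP => x; rewrite !ffunE finset.in_setT. Qed.

(** The extra particle always shares its site, hence walks without sleeping until it is killed. In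
    [hit_solve] with the full set there is nowhere to exit, and only the constant remains. *)
Lemma stabE_add_occupied f eta x : (forall y, nactive eta y != 0%N) ->
  H f (add_active x eta) = H f eta.
Proof.
move=> occ.
have h := @hit_solve _ _ K K_ge0 kill_gt0 full
  (fun x => H f (add_active x eta)) (H f eta).
rewrite h => [|y _].
  by rewrite big_pred0 ?addr0 // => z; rewrite finset.in_setT.
have /nactive_gt0P[k ek] := occ y.
by apply: (topple_fixed_extra lambda_gt0 (k := k)) => //; exact: H_fixed.
Qed.

Lemma stabE_pile_full f zeta : H f (pile zeta full) = H f ones.
Proof.
pose E (s : seq V) : config V := [ffun x => Some (if x \in s then 2 else 1)%N].
have main s : uniq s -> H f (E s) = H f ones.
  elim: s => [_|x s IHs /= /andP[xs us]].
    by congr (H f _); apply/ffunP => x; rewrite !ffunE.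
  rewrite -(IHs us) -(@stabE_add_occupied f (E s) x) => [|y].
    congr (H f _); apply/ffunP => y; rewrite !ffunE inE.
    by case: (y =P x) => [->|] //=; rewrite (negbTE xs).
  by rewrite /nactive ffunE /=; case: ifP.
rewrite -(main (enum [pred x | zeta x]) (enum_uniq _)); congr (H f _).
by apply/ffunP => x; rewrite !ffunE finset.in_setT mem_enum.
Qed.

(** On piles that are not full the expectation is bounded below by 0, and on full ones it does not
    depend on [zeta]. The bound is affine in [unfilled], so iterating [growth] turns it into
    [surv]. *)
Lemma iter_op_ge t f zeta : (forall zeta, 0 <= f zeta) ->
  (1 - surv fill t empty) * H f ones <= iter t op f zeta.
Proof.
move=> f0.
rewrite -(stabE_stable K_ge0 kappa_gt0 kill_ge lambda_gt0 (iter t op f)) -pile_set0.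
rewrite stabE_iter_op_pile.
have -> : (1 - surv fill t empty) * H f ones
    = - H f ones * surv fill t empty + H f ones by ring.
rewrite -iter_growth_affine.
apply: (iter_growth_mono V_gt0 fill_ge sum_fill_le1) => A.
rewrite /unfilled; have [->|AT] := eqVneq A full.
  by rewrite mulr0 add0r stabE_pile_full.
rewrite mulr1 addNr; apply: sumr_ge0 => z _; exact: mulr_ge0.
Qed.

Local Notation all_asleep := ([ffun=> true] : stable_config V).
Local Notation all_empty := ([ffun=> false] : stable_config V).

Lemma nparticles_pile_empty A : nparticles (pile all_empty A) = #|A|.
Proof.
rewrite -sum1_card [RHS]big_mkcond /=; apply: eq_bigr => x _.
by rewrite !ffunE; case: ifP.
Qed.

(* To end with a particle everywhere, all the sites must be filled. *)
Lemma stab_asleep_pile A : A != full -> stb all_asleep (pile all_empty A) = 0.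
Proof.
move=> AT; apply: (@stab_eq0 _ _ _ _ kappa) => //.
rewrite nparticles_pile_empty.
have -> : nparticles (config_of_stable all_asleep) = #|V|.
  by rewrite -sum1_card; apply: eq_bigr => x _; rewrite !ffunE.
by rewrite -cardsT proper_card // finset.properEneq AT finset.subsetT.
Qed.

(** This pair of states attains the bound of [iter_op_ge], which makes [dsep] computable exactly. *)
Lemma iter_op_asleep t :
  iter t op (fun zeta => (zeta == all_asleep)%:R) all_empty
    = (1 - surv fill t empty) * stb all_asleep ones.
Proof.
set f := fun zeta => _.
rewrite -(stabE_stable K_ge0 kappa_gt0 kill_ge lambda_gt0 (iter t op f)) -pile_set0.
rewrite stabE_iter_op_pile.
have -> : (1 - surv fill t empty) * stb all_asleep ones
    = - stb all_asleep ones * surv fill t empty + stb all_asleep ones by ring.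
rewrite -iter_growth_affine; congr (iter t _ _ _); apply/funext => A.
rewrite stabE_indic /unfilled; have [->|AT] := eqVneq A full.
  by rewrite mulr0 add0r pile_false.
by rewrite mulr1 addNr stab_asleep_pile.
Qed.

Lemma arw_mxE i j :
  P i j = \sum_x nu x * stb (enum_val j) (add_active x (config_of_stable (enum_val i))).
Proof.
rewrite mxE; apply: eq_bigr => x _; congr (_ * _).
exact: (@absorption_probE _ _ _ _ kappa).
Qed.

Lemma sum_enum_val (F : stable_config V -> R) :
  \sum_(i < #|{: stable_config V}|) F (enum_val i) = \sum_zeta F zeta.
Proof. by rewrite -(big_enum_val F); apply: eq_bigl => z; rewrite inE. Qed.

Lemma row_mul_arw_mx (mu : stable_config V -> R) j :
  ((\row_i mu (enum_val i)) *m P) 0 j =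
  \sum_zeta mu zeta * op (fun zeta' => (zeta' == enum_val j)%:R) zeta.
Proof.
rewrite mxE -sum_enum_val; apply: eq_bigr => i _; rewrite mxE; congr (_ * _).
rewrite arw_mxE; apply: eq_bigr => x _; congr (_ * _).
by rewrite stabE_indic.
Qed.

Lemma arw_mxX t i j : (P ^+ t) i j
  = iter t op (fun zeta => (zeta == enum_val j)%:R) (enum_val i).
Proof.
elim: t i => [|t IHt] i.
  by rewrite expr0 mxE /= (inj_eq enum_val_inj).
rewrite exprS mxE /=; under eq_bigr do rewrite IHt arw_mxE.
rewrite (sum_enum_val (fun zeta =>
  (\sum_x nu x * stb zeta (add_active x (config_of_stable (enum_val i))))
  * iter t op (fun zeta => (zeta == enum_val j)%:R) zeta)).
under eq_bigr do rewrite mulr_suml.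
rewrite exchange_big /=; apply: eq_bigr => x _; rewrite mulr_sumr.
by apply: eq_bigr => zeta _; rewrite mulrA.
Qed.

Definition pi_row : 'rV[R]_#|{: stable_config V}| := \row_j stb (enum_val j) ones.

Lemma stab_row_mul A j :
  ((\row_i stb (enum_val i) (pile all_empty A)) *m P) 0 j
  = growth fill (fun A => stb (enum_val j) (pile all_empty A)) A.
Proof.
rewrite (row_mul_arw_mx (fun zeta => stb zeta (pile all_empty A))).
rewrite -[LHS]/(H _ _) stabE_op_pile; congr (growth _ _ _).
by apply/funext => B; rewrite stabE_indic.
Qed.

Lemma pi_row_invariant : is_invariant_law P pi_row.
Proof.
split.
- by move=> i; rewrite mxE.
- under eq_bigr do rewrite mxE.
  by rewrite (sum_enum_val (fun zeta => stb zeta ones)) (@sum_stab _ _ _ _ kappa).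
- apply/rowP => j; rewrite /pi_row -pile_false stab_row_mul growth_setT.
  by rewrite mxE.
Qed.

Lemma pi_row_gt0 j : 0 < pi_row 0 j.
Proof. by rewrite mxE; exact: (@stab_gt0 _ _ _ _ kappa). Qed.

Lemma sum_arw_mx i : \sum_j P i j = 1.
Proof.
under eq_bigr do rewrite arw_mxE.
rewrite exchange_big /=; under eq_bigr do rewrite -mulr_sumr.
rewrite -[RHS]sum_nu; apply: eq_bigr => x _.
rewrite (sum_enum_val (fun zeta => stb zeta _)) (@sum_stab _ _ _ _ kappa) //.
by rewrite mulr1.
Qed.

Local Notation s t := (surv fill t empty).

Let P_ge t i j : (1 - s t) * pi_row 0 j <= (P ^+ t) i j.
Proof.
rewrite arw_mxX mxE -stabE_indic.
by apply: iter_op_ge => zeta.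
Qed.

Let s_le t : s t <= n * (1 - n^-1) ^+ t.
Proof.
apply: le_trans (surv_le V_gt0 fill_ge sum_fill_le1 t _) _.
by rewrite finset.setC0 cardsT.
Qed.

Let r_ge0 : 0 <= 1 - n^-1.
Proof. by rewrite subr_ge0 invf_le1 // ler1n. Qed.
Let r_lt1 : 1 - n^-1 < 1.
Proof. by rewrite gtrBl invr_gt0. Qed.

Lemma arw_dsepE t : dsep P t = s t.
Proof.
apply: (@dsepE R _ P pi_row (fun t => s t) n (1 - n^-1) sum_arw_mx
  pi_row_invariant P_ge r_ge0 r_lt1 s_le pi_row_gt0
  (enum_rank all_empty) (enum_rank all_asleep)) => {}t.
by rewrite arw_mxX mxE !enum_rankK iter_op_asleep.
Qed.

(* Leaving out one site [x0] in the initial condition gives a left eigenvector: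
   each new particle fills [x0] with a fixed probability. *)
Lemma arw_trel_bounds : n / d <= trel P <= n.
Proof.
have /card_gt0P[x0 _] := V_gt0.
pose A := ~: [set x0]%SET.
have x0A : x0 \notin A by rewrite finset.in_setC finset.in_set1 eqxx.
have AT : x0 |: A = full by rewrite finset.setUCr.
have AN : A != full.
  by apply: contraNneq x0A => ->; rewrite finset.in_setT.
have notA z : (z \notin A) = (z == x0).
  by rewrite finset.in_setC finset.in_set1 negbK.
have growA G : growth fill G A = G A + fill A x0 * (G full - G A).
  by rewrite /growth (eq_bigl _ _ notA) big_pred1_eq AT.
pose q := fill A x0.
have q1 : q <= 1.
  by have := sum_fill_le1 A; rewrite (eq_bigl _ _ notA) big_pred1_eq.
have qn : n^-1 <= q by exact: fill_ge.
have qd : q <= d / n by exact: fill_le.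
have q0 : 0 < q by apply: lt_le_trans qn; rewrite invr_gt0.
have d0 : 0 < d by have := lt_le_trans q0 qd; rewrite pmulr_lgt0 ?invr_gt0.
pose v := \row_i stb (enum_val i) (pile all_empty A) - pi_row.
have vP : v *m P = (1 - q) *: v.
  apply/rowP => j; have [_ _ piP] := pi_row_invariant.
  rewrite mulmxBl piP mxE stab_row_mul growA pile_false !mxE -/q.
  by ring.
(* At the state with all sites asleep, the first term of [v] vanishes for lack of particles whereas
   [pi_row] is positive. *)
have v0 : v != 0.
  apply: contraTneq (pi_row_gt0 (enum_rank all_asleep)) => e.
  have /(congr1 (fun M : 'rV_ _ => M 0 (enum_rank all_asleep))) := e.
  rewrite !mxE enum_rankK stab_asleep_pile // sub0r => /eqP.
  by rewrite oppr_eq0 => /eqP ->; rewrite ltxx.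
have ez : eigenvalue (map_mx (real_complex R) P) (real_complex R (1 - q)).
  apply/eigenvalueP; exists (map_mx (real_complex R) v).
    by rewrite -map_mxM vP map_mxZ.
  by rewrite map_mx_eq0.
have z1 : real_complex R (1 - q) != 1.
  rewrite -(rmorph1 (real_complex R)) (inj_eq (@complexI R)).
  by rewrite -subr_eq0 addrAC subrr sub0r oppr_eq0 gt_eqF.
have zr : Normc.normc (real_complex R (1 - q)) = 1 - q.
  by rewrite normc_real ger0_norm // subr_ge0.
have /andP[lo up] := @trel_bounds R _ P pi_row (fun t => s t) n (1 - n^-1)
  sum_arw_mx pi_row_invariant P_ge r_ge0 r_lt1 s_le _ _ z1 ez zr.
rewrite opprB addrC subrK in lo; rewrite opprB addrC subrK invrK in up.
rewrite up andbT; apply: le_trans lo.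
by rewrite -invf_div lef_pV2 ?posrE // divr_gt0.
Qed.

(** The asymptotic analysis uses only these bounds; [m] is the expected filling time from the empty
    set. *)
Lemma arw_mixing : exists m : R, [/\
  n / d * harmonic_sum R #|V| <= m <= n * harmonic_sum R #|V|,
  n / d <= trel P <= n,
  forall t, 0 <= dsep P t <= 1,
  forall t, m <= t%:R -> dsep P t * (t%:R - m) ^+ 2 <= n * m
  & forall t, t%:R <= m -> (1 - dsep P t) * (m - t%:R) ^+ 2 <= n * m].
Proof.
have /card_gt0P[x0 _] := V_gt0.
have d0 : 0 < d.
  have /andP[+ _] := arw_trel_bounds; have w0 := w_kill x0.
  have : 0 < w x0 by rewrite lt_neqAle w_ge0 andbT; apply: contraTneq w0 => <-;
    rewrite mul0r ler10.
  by move=> /lt_le_trans/(_ (w_le x0)).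
exists (fill_time fill empty); split.
- apply/andP; split.
    have := fill_time_ge V_gt0 fill_ge d0 fill_le empty.
    by rewrite finset.setC0 cardsT.
  have := fill_time_le V_gt0 fill_ge empty.
  by rewrite finset.setC0 cardsT.
- exact: arw_trel_bounds.
- move=> t; rewrite arw_dsepE (surv_ge0 V_gt0 fill_ge sum_fill_le1) /=.
  exact: (surv_le1 V_gt0 fill_ge sum_fill_le1).
- move=> t mt; rewrite arw_dsepE.
  apply: (@surv_tail_right _ _ _ (fun B y z => hit K B z y)) => //.
  + exact: fill_ge.
  + exact: sum_fill_le1.
  + by move=> *; exact: hit_ge0.
  + by move=> *; exact: sum_hit_le1.
  + by move=> *; exact: fill_setU1.
- move=> t mt; rewrite arw_dsepE.
  apply: (@surv_tail_left _ _ _ (fun B y z => hit K B z y)) => //.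
  + exact: fill_ge.
  + exact: sum_fill_le1.
  + by move=> *; exact: hit_ge0.
  + by move=> *; exact: sum_hit_le1.
  + by move=> *; exact: fill_setU1.
Qed.

End UniformDriving.

(** * Graphs with a sink *)

Section SinkGraph.
Variables (R : realType) (T : finType) (e : rel T) (d n : nat) (s : T).
Variable lambda : R.
Hypothesis n_gt0 : (0 < n)%N.
Hypothesis hG : sink_graph e d n s.
Hypothesis lambda_gt0 : 0 < lambda.

Local Notation V := {x : T | x != s}.
Local Notation K := (restrict_kernel (s := s) (rw_kernel R e)).
Local Notation P := (sink_arw_mx e s lambda).

Let e_sym : symmetric e. Proof. by case: hG. Qed.

Lemma card_nonsink : #|{: V}| = n.
Proof.
case: hG => cT _ _ _ _; rewrite card_sig.
have := cardC1 s; rewrite cT /= => <-; apply: eq_card => x; by rewrite !inE.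
Qed.

(** Without loops, a vertex of degree [n] among [n + 1] must be adjacent to all the others. *)
Lemma sink_adjacent x : x != s -> e x s.
Proof.
case: hG => cT _ irr ds _ xs; rewrite e_sym.
have sub : [set y | e s y]%SET \subset (~: [set s])%SET.
  apply/fintype.subsetP => y; rewrite !inE; apply: contraTneq => ->.
  by rewrite irr.
have /eqP E : [set y | e s y]%SET == (~: [set s])%SET.
  by rewrite eqEcard sub cardsC1 cT /= -ds leqnn.
by have : x \in (~: [set s])%SET; [rewrite !inE | rewrite -E inE].
Qed.

Lemma deg_gt0 (x : V) : (0 < deg e (val x))%N.
Proof.
by rewrite card_gt0; apply/finset.set0Pn; exists s; rewrite inE sink_adjacent // (valP x).
Qed.

Let deg0 (x : V) : (deg e (val x))%:R != 0 :> R.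
Proof. by rewrite pnatr_eq0 -lt0n deg_gt0. Qed.

Lemma kill_rate_sink (x : V) : kill_rate K x = (deg e (val x))%:R^-1.
Proof.
rewrite /kill_rate /restrict_kernel.
have -> : \sum_(y : V) rw_kernel R e (val x) (val y)
    = \sum_(y | y != s) rw_kernel R e (val x) y.
  rewrite [RHS](reindex_omap (val : V -> T) insub) /= => [|y ys]; last first.
    by rewrite insubT.
  by apply: eq_bigl => y; rewrite valK eqxx (valP y).
have -> : \sum_(y | y != s) rw_kernel R e (val x) y
    = 1 - (deg e (val x))%:R^-1.
  have tot : \sum_y rw_kernel R e (val x) y = 1.
    rewrite /rw_kernel -big_mkcond /= sumr_const.
    have -> : #|[pred y | e (val x) y]| = deg e (val x).
      by rewrite /deg; apply: eq_card => y; rewrite !inE.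
    by rewrite -(mulr_natr (_^-1)) mulVf //; exact: deg0.
  apply: (canRL (addrK _)); rewrite -[RHS]tot.
  by rewrite [in RHS](bigD1 s) //= {2}/rw_kernel (sink_adjacent (valP x)) addrC.
by rewrite opprB addrC subrK.
Qed.

Lemma sink_degree_gt0 : (0 < d)%N.
Proof.
have : (0 < #|{: V}|)%N by rewrite card_nonsink.
case/card_gt0P => x _; apply: leq_trans (deg_gt0 x) _.
by case: hG => _ _ _ _ /(_ _ (valP x)).
Qed.

Lemma sink_arw_mixing : exists m : R, [/\
  n%:R / d%:R * harmonic_sum R n <= m <= n%:R * harmonic_sum R n,
  n%:R / d%:R <= trel P <= n%:R,
  forall t, 0 <= dsep P t <= 1,
  forall t, m <= t%:R -> dsep P t * (t%:R - m) ^+ 2 <= n%:R * m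
  & forall t, t%:R <= m -> (1 - dsep P t) * (m - t%:R) ^+ 2 <= n%:R * m].
Proof.
have d0 := sink_degree_gt0.
have deg_le (x : V) : (deg e (val x) <= d)%N.
  by case: hG => _ _ _ _ /(_ _ (valP x)).
(* The degree reverses the walk, and its product with the killing rate is 1. The bound [d] on
   degrees yields both the lower bound [1 / d] on killing and the upper bound on the weights. *)
have := @arw_mixing R V K lambda d%:R^-1 (fun x => (deg e (val x))%:R) d%:R.
rewrite card_nonsink; apply => //.
- by move=> x y; rewrite /restrict_kernel /rw_kernel; case: ifP.
- by rewrite invr_gt0 ltr0n.
- by rewrite invf_le1 ?ler1n // ltr0n.
- move=> x; rewrite kill_rate_sink lef_pV2 ?posrE ?ltr0n ?deg_gt0 //.
  by rewrite ler_nat.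
- move=> x y; rewrite /restrict_kernel /rw_kernel e_sym.
  by case: ifP => _; rewrite ?mulr0 // !mulfV.
- by move=> x; rewrite ler_nat.
- by move=> x; rewrite kill_rate_sink mulfV.
Qed.

End SinkGraph.

(** * Harmonic sums and logarithms *)

Section HarmonicSum.
Variable R : realType.

Lemma ln_le_harmonic_sum n : (0 < n)%N -> ln n%:R <= harmonic_sum R n.
Proof.
case: n => // n _.
(* The shift by one suits the induction, whose step is then
   [ln (1 + 1 / (k + 1)) <= 1 / (k + 1)]. *)
suff : ln n.+2%:R <= harmonic_sum R n.+1.
  by apply: le_trans; rewrite ler_ln ?posrE ?ltr0n // ler_nat.
elim: n.+1 => [|k IHk]; first by rewrite ln1 /harmonic_sum big_ord0.
rewrite /harmonic_sum big_ord_recr /= -/(harmonic_sum R k).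
have -> : k.+2%:R = k.+1%:R * (1 + k.+1%:R^-1) :> R.
  by rewrite mulrDr mulfV ?pnatr_eq0 // mulr1 natr1.
rewrite lnM ?posrE ?ltr0n ?addr_gt0 ?invr_gt0 ?ltr0n // lerD //.
by apply: le_ln1Dx; rewrite (lt_trans (ltrN10 _)) // invr_gt0 ltr0n.
Qed.

Lemma harmonic_sum_le n : (0 < n)%N -> harmonic_sum R n <= 1 + ln n%:R.
Proof.
case: n => // n _; elim: n => [|k IHk].
  by rewrite ln1 /harmonic_sum big_ord1 invr1 addr0.
rewrite /harmonic_sum big_ord_recr /= -/(harmonic_sum R k.+1).
apply: le_trans (lerD IHk (lexx _)) _; rewrite -addrA lerD2l.
have k2 : 0 < k.+2%:R :> R by rewrite ltr0n.
have : ln (1 - k.+2%:R^-1) <= - k.+2%:R^-1 :> R.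
  apply: le_ln1Dx; rewrite ltrN2 invf_lt1 // ltr1n //.
have -> : 1 - k.+2%:R^-1 = k.+1%:R / k.+2%:R :> R.
  by rewrite -[X in X - _](@mulfV _ k.+2%:R) ?gt_eqF // -{2}[_^-1]mul1r -mulrBl -natr1 addrK.
rewrite ln_div ?posrE ?ltr0n //.
by rewrite lerBlDr -lerBlDl opprK addrC.
Qed.

End HarmonicSum.

(** * Cutoff *)

Section SeparationTime.
Variables (R : realType) (k : nat) (P : 'M[R]_k) (N M : R).
Hypothesis N_gt0 : 0 < N.
Hypothesis M_gt0 : 0 < M.
Hypothesis tail_right :
  forall t, M <= t%:R -> dsep P t * (t%:R - M) ^+ 2 <= N * M.
Hypothesis tail_left :
  forall t, t%:R <= M -> (1 - dsep P t) * (M - t%:R) ^+ 2 <= N * M.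

Let NM_gt0 : 0 < N * M. Proof. exact: mulr_gt0. Qed.

Lemma tsep_eps_witness (eps : R) : 0 < eps ->
  exists2 t : nat, dsep P t <= eps & t%:R <= M + Num.sqrt (N * M / eps) + 1.
Proof.
move=> e0; set b := Num.sqrt (N * M / eps).
have b0 : 0 < b by rewrite sqrtr_gt0 divr_gt0.
have Mb0 : 0 <= M + b by rewrite addr_ge0 ?ltW.
have /andP[t1 t2] := truncn_itv Mb0.
(* The successor of the integer part lies above [M + b], at the cost of the final [+ 1]. *)
exists (Num.truncn (M + b)).+1; last by rewrite -natr1 lerD2r.
have h : M <= (Num.truncn (M + b)).+1%:R.
  by apply: le_trans (ltW t2); rewrite lerDl ltW.
have := tail_right h; set x := _%:R - M.
have bx : b <= x by rewrite lerBrDl ltW.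
have x2 : N * M / eps <= x ^+ 2.
  rewrite -(@sqr_sqrtr _ (N * M / eps)) ?divr_ge0 ?(ltW NM_gt0) ?(ltW e0) // -/b.
  by rewrite lerXn2r // nnegrE ltW // (lt_le_trans b0).
have x0 : 0 < x ^+ 2 by apply: lt_le_trans x2; rewrite divr_gt0.
rewrite -ler_pdivlMr // => /le_trans; apply.
by rewrite ler_pdivrMr // [leRHS]mulrC -ler_pdivrMr.
Qed.

Lemma tsep_eps_le (eps : R) : 0 < eps ->
  tsep_eps P eps <= M + Num.sqrt (N * M / eps) + 1.
Proof.
move=> /tsep_eps_witness[t dt tle]; apply: le_trans tle.
apply: ge_inf; last by exists t.
by exists 0 => _ [u _ <-].
Qed.

Lemma tsep_eps_ge (eps : R) : 0 < eps -> eps < 1 ->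
  M - Num.sqrt (N * M / (1 - eps)) <= tsep_eps P eps.
Proof.
move=> e0 e1; apply: lb_le_inf.
  (* The infimum of an empty set is a default value, so a time in the set has to be exhibited. *)
  by have [t dt _] := tsep_eps_witness e0; exists t%:R => /=; exists t.
move=> _ [t /= dt <-]; rewrite leNgt; apply/negP.
set b := Num.sqrt _ => tb.
have e1' : 0 < 1 - eps by rewrite subr_gt0.
have b0 : 0 < b by rewrite sqrtr_gt0 divr_gt0.
have tM : t%:R <= M by apply: ltW; apply: lt_trans tb _; rewrite gtrBl.
have := tail_left tM; apply/negP; rewrite -ltNge.
set x := M - t%:R.
have bx : b < x by rewrite /x ltrBrDl addrC -ltrBrDl.
have x2 : N * M / (1 - eps) < x ^+ 2.
  rewrite -(@sqr_sqrtr _ (N * M / (1 - eps))) ?divr_ge0 ?(ltW NM_gt0) ?(ltW e1') //.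
  by rewrite -/b ltrXn2r // ?nnegrE ltW // (lt_trans b0).
apply: (@lt_le_trans _ _ ((1 - eps) * x ^+ 2)); last first.
  by rewrite ler_wpM2r ?sqr_ge0 // lerD2l lerN2.
by rewrite [ltRHS]mulrC -ltr_pdivrMr.
Qed.

End SeparationTime.

(** * Orders of magnitude, limits and window *)

Section Asymptotics.
Variables (R : realType) (k : nat -> nat) (P : forall n, 'M[R]_(k n)) (d : R).
Variable M : nat -> R.
Hypothesis d_gt0 : 0 < d.
Hypothesis M_bounds : forall n, (0 < n)%N ->
  n%:R / d * harmonic_sum R n <= M n <= n%:R * harmonic_sum R n.
Hypothesis trel_bnd : forall n, (0 < n)%N -> n%:R / d <= trel (P n) <= n%:R.
Hypothesis dsep01 : forall n, (0 < n)%N -> forall t, 0 <= dsep (P n) t <= 1.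
Hypothesis right_tail : forall n, (0 < n)%N -> forall t, M n <= t%:R ->
  dsep (P n) t * (t%:R - M n) ^+ 2 <= n%:R * M n.
Hypothesis left_tail : forall n, (0 < n)%N -> forall t, t%:R <= M n ->
  (1 - dsep (P n) t) * (M n - t%:R) ^+ 2 <= n%:R * M n.

Local Notation L n := (ln n%:R : R).

Lemma near_ln_ge (A : R) : \forall n \near \oo, A <= L n.
Proof.
near=> n; have n0 : (0 < n)%N by near: n; exact: nbhs_infty_gt.
have h : expR A <= n%:R by near: n; exact: nbhs_infty_ger.
by rewrite -[leLHS]expRK ler_ln ?posrE ?expR_gt0 ?ltr0n.
Unshelve. all: by end_near. Qed.

Lemma M_ge n : (0 < n)%N -> n%:R * L n <= d * M n.
Proof.
move=> n0; have /andP[h _] := M_bounds n0.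
rewrite -ler_pdivrMl //; apply: le_trans h; rewrite mulrCA mulrA.
by rewrite ler_wpM2l ?divr_ge0 ?(ltW d_gt0) // ln_le_harmonic_sum.
Qed.

Lemma M_le n : (0 < n)%N -> 1 <= L n -> M n <= 2 * (n%:R * L n).
Proof.
move=> n0 L1; have /andP[_ h] := M_bounds n0; apply: le_trans h _.
rewrite mulrCA ler_wpM2l // (le_trans (harmonic_sum_le R n0)) //.
by move: (ln _) L1 => x; lra.
Qed.

(* The product condition: [n] is the order of the relaxation time, and [M n]
   that of the separation time. *)
Lemma near_le_M (c : R) : 0 < c -> \forall n \near \oo, n%:R <= c * M n.
Proof.
move=> c0; near=> n.
have n0 : (0 < n)%N by near: n; exact: nbhs_infty_gt.
have hL : d / c <= L n by near: n; exact: near_ln_ge.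
have h := M_ge n0.
rewrite -ler_pdivrMl // -(ler_pM2l d_gt0); apply: le_trans h.
by rewrite mulrC mulrAC mulrC ler_wpM2l // mulrC.
Unshelve. all: by end_near. Qed.

Lemma M_gt0 n : (0 < n)%N -> 0 < M n.
Proof.
move=> n0; have /andP[h _] := M_bounds n0; apply: lt_le_trans h.
rewrite mulr_gt0 ?divr_gt0 ?ltr0n //; case: n n0 => // n _.
rewrite /harmonic_sum big_ord_recl ltr_pwDl ?invr_gt0 ?ltr0n //.
by apply: sumr_ge0 => i _; rewrite invr_ge0.
Qed.

Lemma near_sqrt_le (c delta : R) : 0 < c -> 0 < delta ->
  \forall n \near \oo, Num.sqrt (n%:R * M n / c) + 1 <= delta * M n.
Proof.
move=> c0 dl0; near=> n.
have n0 : (0 < n)%N by near: n; exact: nbhs_infty_gt.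
have M0 := M_gt0 n0.
have h1 : n%:R <= c * (delta / 2) ^+ 2 * M n.
  by near: n; apply: near_le_M; rewrite mulr_gt0 ?exprn_gt0 ?divr_gt0.
have h2 : n%:R <= delta / 2 * M n by near: n; apply: near_le_M; rewrite divr_gt0.
have h3 : 1 <= delta / 2 * M n by apply: le_trans h2; rewrite ler1n.
suff : Num.sqrt (n%:R * M n / c) <= delta / 2 * M n.
  by move: (Num.sqrt _) => x xle; lra.
have dM : 0 <= delta / 2 * M n by apply: le_trans h3.
rewrite -[leRHS]ger0_norm // -sqrtr_sqr ler_wsqrtr // ler_pdivrMr // exprMn.
have -> : (delta / 2) ^+ 2 * M n ^+ 2 * c = c * (delta / 2) ^+ 2 * M n * M n by ring.
by rewrite ler_wpM2r // ltW.
Unshelve. all: by end_near. Qed.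

Lemma tsep_close (delta : R) : 0 < delta -> \forall n \near \oo,
  (1 - delta) * M n <= tsep (P n) /\ tsep (P n) <= (1 + delta) * M n.
Proof.
move=> dl0; near=> n.
have n0 : (0 < n)%N by near: n; exact: nbhs_infty_gt.
have M0 := M_gt0 n0; have n0' : 0 < n%:R :> R by rewrite ltr0n.
have h : Num.sqrt (n%:R * M n / 2^-1) + 1 <= delta * M n.
  by near: n; apply: near_sqrt_le; rewrite ?invr_gt0.
have e0 : 0 < 2^-1 :> R by rewrite invr_gt0.
have e1 : 2^-1 < 1 :> R by rewrite invf_lt1 // ltr1n.
have up := tsep_eps_le n0' M0 (right_tail n0) e0.
have lo := tsep_eps_ge n0' M0 (right_tail n0) (left_tail n0) e0 e1.
have e2 : 1 - 2^-1 = 2^-1 :> R by lra.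
rewrite e2 in lo; rewrite /tsep.
by move: (Num.sqrt _) (tsep_eps _ _) h up lo => x y h up lo; split; lra.
Unshelve. all: by end_near. Qed.

Lemma trel_Theta :
  ((fun n => trel (P n)) : nat -> R^o) =Theta_\oo ((fun n => n%:R) : nat -> R^o).
Proof.
rewrite eqThetaE qualifE; apply/asboolP.
exists (d^-1, 1); first by rewrite /= invr_gt0 d_gt0 ltr01.
near=> n; have n0 : (0 < n)%N by near: n; exact: nbhs_infty_gt.
have /andP[h1 h2] := trel_bnd n0.
have t0 : 0 <= trel (P n) by apply: le_trans h1; rewrite divr_ge0 // ltW.
by rewrite /= mul1r !ger0_norm // mulrC.
Unshelve. all: by end_near. Qed.

Lemma tsep_Theta : ((fun n => tsep (P n)) : nat -> R^o)
  =Theta_\oo ((fun n => n%:R * ln (n%:R)) : nat -> R^o).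
Proof.
rewrite eqThetaE qualifE; apply/asboolP.
(* Eventually [tsep] is between [M / 2] and [3 / 2 * M], and [M] between [n * ln n / d] and
   [2 * n * ln n]; the constant 4 leaves room above 3. *)
exists ((2 * d)^-1, 4); first by rewrite /= invr_gt0 mulr_gt0 //=.
near=> n; have n0 : (0 < n)%N by near: n; exact: nbhs_infty_gt.
have L1 : 1 <= L n by near: n; exact: near_ln_ge.
have [lo up] : (1 - 2^-1) * M n <= tsep (P n) /\ tsep (P n) <= (1 + 2^-1) * M n.
  by near: n; apply: tsep_close; rewrite invr_gt0.
have h1 := M_ge n0; have h2 := M_le n0 L1; have M0 := M_gt0 n0.
have t0 : 0 <= tsep (P n) by move: (tsep _) lo => x; lra.
have nL : 0 <= n%:R * L n by rewrite mulr_ge0 // (le_trans ler01).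
rewrite /= !ger0_norm //; split.
  rewrite ler_pdivrMl ?mulr_gt0 //; apply: le_trans h1 _.
  rewrite -mulrA mulrCA ler_pM2l //; move: (tsep _) lo => x; lra.
by move: (tsep _) (n%:R * L n) up h2 => x y; lra.
Unshelve. all: by end_near. Qed.

Lemma ratio_cvg0 (delta : R) : 0 < delta ->
  n%:R * M n / (delta * M n) ^+ 2 @[n --> \oo] --> (0 : R).
Proof.
move=> dl0; apply/cvgrPdist_le => eps eps0; near=> n.
have n0 : (0 < n)%N by near: n; exact: nbhs_infty_gt.
have M0 := M_gt0 n0.
have h : n%:R <= eps * delta ^+ 2 * M n.
  by near: n; apply: near_le_M; rewrite mulr_gt0 ?exprn_gt0.
rewrite sub0r normrN ger0_norm ?divr_ge0 ?sqr_ge0 ?mulr_ge0 ?(ltW M0) //.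
rewrite ler_pdivrMr ?exprn_gt0 ?mulr_gt0 // exprMn.
have -> : eps * (delta ^+ 2 * M n ^+ 2) = eps * delta ^+ 2 * M n * M n by ring.
by rewrite ler_wpM2r // ltW.
Unshelve. all: by end_near. Qed.

Lemma cutoff_left (alpha : R) : 0 <= alpha -> alpha < 1 ->
  dsep (P n) (Num.truncn (alpha * tsep (P n))) @[n --> \oo] --> (1 : R).
Proof.
(* Here [alpha * M = M - 2 * delta * M]: one [delta * M] covers the error on [tsep], the other is
   the gap left below [M]. *)
move=> a0 a1; pose delta := (1 - alpha) / 2.
have dl0 : 0 < delta by rewrite divr_gt0 // subr_gt0.
have h : 1 - n%:R * M n / (delta * M n) ^+ 2 @[n --> \oo] --> (1 : R).
  by rewrite -[X in _ --> X]subr0; apply: cvgB; [exact: cvg_cst|exact: ratio_cvg0].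
apply: (squeeze_cvgr _ h (cvg_cst (1 : R))); near=> n.
have n0 : (0 < n)%N by near: n; exact: nbhs_infty_gt.
have M0 := M_gt0 n0.
have [lo up] : (1 - delta) * M n <= tsep (P n) /\ tsep (P n) <= (1 + delta) * M n.
  by near: n; exact: tsep_close.
set t := Num.truncn _.
have at0 : 0 <= alpha * tsep (P n).
  rewrite mulr_ge0 // (le_trans _ lo) // mulr_ge0 ?(ltW M0) //.
  by rewrite /delta; lra.
have tle : t%:R <= alpha * tsep (P n) by have /andP[] := truncn_itv at0.
have gap : delta * M n <= M n - t%:R.
  have h1 : alpha * tsep (P n) <= alpha * ((1 + delta) * M n) by rewrite ler_wpM2l.
  have h2 : alpha * (delta * M n) <= 1 * (delta * M n).
    by apply: ler_wpM2r; [rewrite mulr_ge0 // ltW|exact: ltW].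
  have h3 : alpha * M n = M n - 2 * (delta * M n) by rewrite /delta; field.
  move: h1; rewrite mulrDl mul1r mulrDr h3 => h1.
  by move: (t%:R) (alpha * tsep _) tle h1 h2 => x y; lra.
have dM0 : 0 < delta * M n by exact: mulr_gt0.
have tM : t%:R <= M n by rewrite -subr_ge0 (le_trans (ltW dM0)).
have /andP[s0 s1] := dsep01 n0 t.
rewrite s1 andbT lerBlDl -lerBlDr.
rewrite ler_pdivlMr ?exprn_gt0 //; apply: le_trans (left_tail n0 tM).
rewrite ler_wpM2l ?subr_ge0 //.
by rewrite lerXn2r ?nnegrE ?(ltW dM0) // (le_trans (ltW dM0)).
Unshelve. all: by end_near. Qed.

Lemma cutoff_right (alpha : R) : 1 < alpha ->
  dsep (P n) (Num.truncn (alpha * tsep (P n))) @[n --> \oo] --> (0 : R).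
Proof.
move=> a1; have a0 : 0 < alpha by exact: lt_trans a1.
(* Here [alpha * M = M + 2 * delta * M]. The error on [tsep], scaled by [alpha], takes
   [delta / 2 * M] and rounding down takes at most as much, so a gap of [delta * M] remains. *)
pose delta := (alpha - 1) / 2; pose delta' := delta / 2 / alpha.
have dl0 : 0 < delta by rewrite divr_gt0 // subr_gt0.
have dl0' : 0 < delta' by rewrite divr_gt0 // divr_gt0.
apply: (squeeze_cvgr _ (cvg_cst 0) (ratio_cvg0 dl0)); near=> n.
have n0 : (0 < n)%N by near: n; exact: nbhs_infty_gt.
have M0 := M_gt0 n0.
have [lo up] : (1 - delta') * M n <= tsep (P n) /\ tsep (P n) <= (1 + delta') * M n.
  by near: n; exact: tsep_close.
have one : n%:R <= delta / 2 * M n by near: n; apply: near_le_M; rewrite divr_gt0.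
have {}one : 1 <= delta / 2 * M n by apply: le_trans one; rewrite ler1n.
set t := Num.truncn _.
have h1 : alpha * ((1 - delta') * M n) <= alpha * tsep (P n) by rewrite ler_pM2l.
have h3 : alpha * ((1 - delta') * M n) = M n + 2 * (delta * M n) - delta / 2 * M n.
  by rewrite /delta' /delta; field; rewrite gt_eqF.
have dM0 : 0 < delta * M n by exact: mulr_gt0.
have at0 : 0 <= alpha * tsep (P n).
  by apply: le_trans h1; rewrite h3; lra.
have tge : alpha * tsep (P n) < t%:R + 1.
  by have /andP[_] := truncn_itv at0; rewrite -natr1.
have gap : delta * M n <= t%:R - M n.
  rewrite h3 in h1; have e : delta / 2 * M n = delta * M n / 2 by rewrite mulrAC.
  rewrite e in one h1.
  move: tge h1 one; move: (t%:R) (alpha * tsep _) (delta * M n) => x y z; lra.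
have tM : M n <= t%:R by rewrite -subr_ge0 (le_trans (ltW dM0)).
have /andP[s0 s1] := dsep01 n0 t.
rewrite s0 /= ler_pdivlMr ?exprn_gt0 //; apply: le_trans (right_tail n0 tM).
rewrite ler_wpM2l //.
by rewrite lerXn2r ?nnegrE ?(ltW dM0) // (le_trans (ltW dM0)).
Unshelve. all: by end_near. Qed.

Lemma cutoff : separation_cutoff P.
Proof.
by move=> alpha a0; split => a1; [exact: cutoff_left|exact: cutoff_right].
Qed.

Lemma cutoff_window :
  separation_cutoff_window P (fun n => n%:R * Num.sqrt (ln (n%:R))).
Proof.
split; first exact: cutoff.
move=> eps e0 e2; apply/eqO_exP.
have e1 : eps < 1 by lra.
have e1' : 0 < 1 - eps by rewrite subr_gt0.
have e1'' : 1 - eps < 1 by lra.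
(* Each of the two times deviates from [M] by at most [sqrt (n * M / eps)], up to rounding, and
   [M <= 2 * n * ln n] bounds this by [sqrt (2 / eps) * n * sqrt (ln n)]. The last [+ 1] absorbs the
   rounding. *)
exists (2 * Num.sqrt (2 / eps) + 1).
  by rewrite ltr_wpDl // mulr_ge0 // sqrtr_ge0.
near=> n; have n0 : (0 < n)%N by near: n; exact: nbhs_infty_gt.
have L1 : 1 <= L n by near: n; exact: near_ln_ge.
have M0 := M_gt0 n0; have n0' : 0 < n%:R :> R by rewrite ltr0n.
have L0 : 0 <= L n by exact: le_trans L1.
have Mle := M_le n0 L1.
have up1 := tsep_eps_le n0' M0 (right_tail n0) e0.
have up2 := tsep_eps_le n0' M0 (right_tail n0) e1'.
have lo1 := tsep_eps_ge n0' M0 (right_tail n0) (left_tail n0) e0 e1.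
have lo2 := tsep_eps_ge n0' M0 (right_tail n0) (left_tail n0) e1' e1''.
have ee : 1 - (1 - eps) = eps by rewrite opprB addrC subrK.
rewrite ee in lo2.
have mono : Num.sqrt (n%:R * M n / (1 - eps)) <= Num.sqrt (n%:R * M n / eps).
  rewrite ler_wsqrtr // ler_wpM2l ?mulr_ge0 ?(ltW M0) //.
  by rewrite lef_pV2 ?posrE //; lra.
have sq : Num.sqrt (n%:R * M n / eps)
    <= Num.sqrt (2 / eps) * (n%:R * Num.sqrt (L n)).
  have -> : n%:R * Num.sqrt (L n) = Num.sqrt (n%:R ^+ 2 * L n).
    by rewrite sqrtrM ?sqr_ge0 // sqrtr_sqr ger0_norm.
  rewrite -sqrtrM ?divr_ge0 ?(ltW e0) // ler_wsqrtr //.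
  rewrite [leRHS](_ : _ = n%:R * (2 * (n%:R * L n)) / eps); last by field; rewrite gt_eqF.
  by rewrite ler_wpM2r ?invr_ge0 ?(ltW e0) // ler_wpM2l.
have nsL : 1 <= n%:R * Num.sqrt (L n).
  rewrite -[leLHS]mulr1 ler_pM ?ler1n //.
  by rewrite -[leLHS]sqrtr1 ler_wsqrtr.
rewrite [X in _ <= _ * X]ger0_norm ?mulr_ge0 ?sqrtr_ge0 // mulrDl mul1r -mulrA.
rewrite ler_norml; move: up1 up2 lo1 lo2 sq nsL mono.
move: (n%:R * Num.sqrt (L n)) => b.
move: (Num.sqrt (2 / eps)) => a.
move: (tsep_eps _ eps) (tsep_eps _ (1 - eps)) => x y.
move: (Num.sqrt (_ / (1 - eps))) (Num.sqrt (_ / eps)) => u v *.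
by apply/andP; split; lra.
Unshelve. all: by end_near. Qed.

End Asymptotics.

Theorem corollary3 (R : realType) (d : nat) (T : nat -> finType)
    (e : forall n, rel (T n)) (s : forall n, T n) (lambda : nat -> R)
    (hG : forall n, (0 < n)%N -> sink_graph (e n) d n (s n))
    (hlambda : forall n, (0 < n)%N -> 0 < lambda n) :
  [/\ ((fun n => trel (sink_arw_mx (e n) (s n) (lambda n))) : nat -> R^o)
        =Theta_\oo ((fun n => n%:R) : nat -> R^o),
      ((fun n => tsep (sink_arw_mx (e n) (s n) (lambda n))) : nat -> R^o)
        =Theta_\oo ((fun n => n%:R * ln (n%:R)) : nat -> R^o),
      separation_cutoff (fun n => sink_arw_mx (e n) (s n) (lambda n))
    & separation_cutoff_window (fun n => sink_arw_mx (e n) (s n) (lambda n))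
        (fun n => n%:R * Num.sqrt (ln (n%:R)))].
Proof.
have d0 : 0 < d%:R :> R by rewrite ltr0n (sink_degree_gt0 (ltn0Sn 0) (hG 1%N isT)).
pose P n := sink_arw_mx (e n) (s n) (lambda n).
have /choice[M hM] : forall n, exists m : R, (0 < n)%N -> [/\
  n%:R / d%:R * harmonic_sum R n <= m <= n%:R * harmonic_sum R n,
  n%:R / d%:R <= trel (P n) <= n%:R,
  forall t, 0 <= dsep (P n) t <= 1,
  forall t, m <= t%:R -> dsep (P n) t * (t%:R - m) ^+ 2 <= n%:R * m
  & forall t, t%:R <= m -> (1 - dsep (P n) t) * (m - t%:R) ^+ 2 <= n%:R * m].
  (* Nothing is known of the chain for [n = 0], where 0 is a filler value. *)
  case=> [|n]; first by exists 0.
  have [m hm] := sink_arw_mixing (ltn0Sn n) (hG n.+1 isT) (hlambda n.+1 isT).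
  by exists m.
have h1 n : (0 < n)%N -> _ := fun n0 => let: And5 h _ _ _ _ := hM n n0 in h.
have h2 n : (0 < n)%N -> _ := fun n0 => let: And5 _ h _ _ _ := hM n n0 in h.
have h3 n : (0 < n)%N -> _ := fun n0 => let: And5 _ _ h _ _ := hM n n0 in h.
have h4 n : (0 < n)%N -> _ := fun n0 => let: And5 _ _ _ h _ := hM n n0 in h.
have h5 n : (0 < n)%N -> _ := fun n0 => let: And5 _ _ _ _ h := hM n n0 in h.
split.
- exact: trel_Theta d0 h2.
- exact: tsep_Theta d0 h1 h4 h5.
- exact: cutoff d0 h1 h3 h4 h5.
- exact: cutoff_window d0 h1 h3 h4 h5.
Qed.
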